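(* Let $l\ge1$ and $m\ge3$ be integers and let $G=C_{lm}(S)$ with $S=\{s\in\{1,\dots,\lfloor lm/2\rfloor\}: s=l\text{ or } l\nmid s\}$ (equivalently, the join of $l$ copies of the cycle $C_m$). Then (i) $\nu(G)=\lfloor m/3\rfloor$; (ii) $G$ is well-covered (respectively Buchsbaum) if and only if $m\in\{3,4,5,7\}$; (iii) $G$ is vertex decomposable (respectively shellable, Cohen–Macaulay, sequentially Cohen–Macaulay) if and only if either $l=1$ and $m\in\{3,5\}$, or $l\ge2$ and $m=3$; (iv) $G$ satisfies $S_2$ if and only if either $l=1$ and $m\in\{3,5,7\}$, or $l\ge2$ and $m=3$.
   Context: The circulant graph $C_n(S)$ ($S\subseteq\{1,\dots,\lfloor n/2\rfloor\}$) has vertex set $\{0,\dots,n-1\}$ with $\{a,b\}$ an edge iff $\min(|a-b|,n-|a-b|)\in S$. Fix a field $\mathbb{K}$. $\Delta_G$ is the independence complex of $G$. $G$ is well-covered if all maximal independent sets have the same cardinality. $\nu(G)$ is the maximum number of edges in an induced matching (pairwise disjoint edges such that the induced subgraph on their endpoints has exactly these edges). For a face $F$, $\mathrm{lk}(F)=\{H\in\Delta:H\cap F=\emptyset,H\cup F\in\Delta\}$, $\mathrm{del}(F)=\{H\in\Delta:H\cap F=\emptyset\}$. $G$ is Cohen–Macaulay if $\widetilde H_i(\mathrm{lk}_{\Delta_G}(F);\mathbb{K})=0$ for every face $F$ and $i<\dim\mathrm{lk}_{\Delta_G}(F)$; Buchsbaum if $G\setminus N_G[x]$ is Cohen–Macaulay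 for every vertex $x$; $S_2$ if $\mathrm{lk}_{\Delta_G}(F)$ is connected for every face $F$ with $\dim\mathrm{lk}_{\Delta_G}(F)\ge1$; sequentially Cohen–Macaulay if each pure $i$-th skeleton of $\Delta_G$ (generated by the $i$-dimensional faces) is Cohen–Macaulay. A pure complex is vertex decomposable if it is a simplex or has a vertex $x$ with $\mathrm{lk}(x)$, $\mathrm{del}(x)$ vertex decomposable; shellable if pure with a facet order $F_1<\dots<F_r$ such that for all $j<i$ there are $x\in F_i\setminus F_j$ and $k<i$ with $F_i\setminus F_k=\{x\}$. $G$ has a property when $\Delta_G$ does. *)

(* Defs.v *)
From HB Require Import structures.
From mathcomp Require Import all_boot all_order all_algebra.
Set Implicit Arguments. Unset Strict Implicit. Unset Printing Implicit Defensive.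
Import GRing.Theory.

Definition circulant (n : nat) (S : pred nat) : rel 'I_n :=
  fun a b => let d := (maxn a b - minn a b)%N in minn d (n - d) \in S.

Arguments circulant : clear implicits.

Definition join_conn (l m : nat) : pred nat :=
  [pred s | [&& 1 <= s, s <= (l * m)./2 & (s == l) || ~~ (l %| s)]].

Definition joinG (l m : nat) : rel 'I_(l * m) := circulant (l * m) (join_conn l m).

Arguments joinG : clear implicits.

Section Graphs.
Variable T : finType.

Definition independent (G : rel T) (A : {set T}) : bool :=
  [forall u in A, forall v in A, ~~ G u v].

Definition indcomplex (G : rel T) : {set {set T}} := [set A | independent G A].

Definition maximal_independent (G : rel T) (A : {set T}) : bool :=
  independent G A && [forall B : {set T}, (A \proper B) ==> ~~ independent G B].

Definition well_covered (G : rel T) : Prop :=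
  forall A B, maximal_independent G A -> maximal_independent G B -> #|A| = #|B|.

Definition induced_matching (G : rel T) (M : {set {set T}}) : bool :=
  [&& [forall e in M, exists u, exists v, (u != v) && G u v && (e == [set u; v])],
      [forall e in M, forall f in M, (e != f) ==> [disjoint e & f]] &
      [forall u in cover M, forall v in cover M, G u v ==> ([set u; v] \in M)]].

Definition induced_matching_number (G : rel T) : nat :=
  \max_(M : {set {set T}} | induced_matching G M) #|M|.

Definition link (D : {set {set T}}) (F : {set T}) : {set {set T}} :=
  [set H in D | [disjoint H & F] && (H :|: F \in D)].

Definition deletion (D : {set {set T}}) (F : {set T}) : {set {set T}} :=
  [set H in D | [disjoint H & F]].

(* number of vertices of a largest face = dim + 1 *)
Definition dsize (D : {set {set T}}) : nat := \max_(F in D) #|F|.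

Definition facets (D : {set {set T}}) : {set {set T}} :=
  [set F in D | [forall H in D, (F \subset H) ==> (H == F)]].

Definition pure (D : {set {set T}}) : Prop :=
  forall F H, F \in facets D -> H \in facets D -> #|F| = #|H|.

Definition faces (D : {set {set T}}) (k : nat) : {set {set T}} :=
  [set F in D | #|F| == k].

(* simplicial boundary map from k-element faces to (k-1)... : matrix whose rows
   are the faces with k elements, columns the faces with k+1 elements
   (vertices ordered by enum_rank) *)
Definition bnd (K : fieldType) (D : {set {set T}}) (k : nat)
  : 'M[K]_(#|faces D k|, #|faces D k.+1|) :=
  \matrix_(i < #|faces D k|, j < #|faces D k.+1|)
    (let G : {set T} := @enum_val _ (mem (faces D k)) i in
     let F : {set T} := @enum_val _ (mem (faces D k.+1)) j in
     if G \subset F then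
       \sum_(v in F :\: G) (-1) ^+ #|[set u in F | (enum_rank u < enum_rank v)%N]|
     else 0)%R.

(* dimension over K of the reduced homology H~_{k-1}(D; K)
   (chains of faces with k elements; k = 0 is the empty face, i.e. degree -1) *)
Definition rbetti (K : fieldType) (D : {set {set T}}) (k : nat) : nat :=
  (#|faces D k| - (if k is k'.+1 then \rank (bnd K D k') else 0)
                - \rank (bnd K D k))%N.

(* Cohen-Macaulay over K: H~_i(lk F) = 0 for every face F and i < dim lk F,
   i.e. for k = i+1 < dsize (lk F). *)
Definition CM (K : fieldType) (D : {set {set T}}) : Prop :=
  forall F, F \in D -> forall k, k < dsize (link D F) -> rbetti K (link D F) k = 0%N.

Definition connected_complex (D : {set {set T}}) : Prop :=
  forall u v, [set u] \in D -> [set v] \in D ->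
    connect (fun a b => [set a; b] \in D) u v.

Definition S2 (D : {set {set T}}) : Prop :=
  forall F, F \in D -> 2 <= dsize (link D F) -> connected_complex (link D F).

(* pure i-th skeleton, indexed by k = i+1 elements *)
Definition pure_skeleton (D : {set {set T}}) (k : nat) : {set {set T}} :=
  [set F in D | [exists H in D, (#|H| == k) && (F \subset H)]].

Definition seqCM (K : fieldType) (D : {set {set T}}) : Prop :=
  forall k, CM K (pure_skeleton D k).

Definition is_simplex (D : {set {set T}}) : Prop := exists F, D = powerset F.

Inductive vertex_decomposable : {set {set T}} -> Prop :=
| vd_simplex D : pure D -> is_simplex D -> vertex_decomposable D
| vd_step D x : pure D -> [set x] \in D ->
    vertex_decomposable (link D [set x]) ->
    vertex_decomposable (deletion D [set x]) -> vertex_decomposable D.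

Definition shellable (D : {set {set T}}) : Prop :=
  pure D /\
  exists s : seq {set T}, [/\ uniq s, [set F in s] = facets D &
    forall i j, (j < i < size s)%N ->
      exists x, x \in nth set0 s i :\: nth set0 s j /\
        exists k, (k < i)%N /\ nth set0 s i :\: nth set0 s k = [set x]].

Definition closed_nbhd (G : rel T) (x : T) : {set T} := x |: [set y | G x y].

Definition indcomplex_minus_nbhd (G : rel T) (x : T) : {set {set T}} :=
  [set A in indcomplex G | [disjoint A & closed_nbhd G x]].

Definition buchsbaum (K : fieldType) (G : rel T) : Prop :=
  forall x, CM K (indcomplex_minus_nbhd G x).

End Graphs.

(* Main.v *)
Require Import Defs.
From mathcomp Require Import all_boot all_order all_algebra.
From mathcomp Require Import zify ring.

Set Implicit Arguments.
Unset Strict Implicit.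
Unset Printing Implicit Defensive.

Import GRing.Theory.

(* Vertex [r + l * i] is vertex [i] of the [r]-th of [l] copies of the cycle
   [C_m], and vertices of different copies are adjacent, so a nonempty
   independent set lives in one copy and the complex is the disjoint union of
   [l] copies of that of [C_m].

   If [m = 6] or [m >= 8], some face has the independence complex of the path on
   three vertices as its link; this excludes purity, the Buchsbaum property,
   Cohen-Macaulayness and [S2] at once.  For [m = 4], or [l >= 2] and [m >= 4],
   the complex is disconnected of positive dimension.

   Sequential Cohen-Macaulayness for [l = 1] fails on the pure skeleton spanned
   by the independent sets of size [m./2].  When [m] is even it is disconnected,
   because such a set has vertices of a single parity.  When [m] is odd, consecutive
   elements of such a set are at distance 2 except for one pair at distance 3,
   so the skeleton winds around a circle; [odd_cycle_not_acyclic1] exhibits a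
   1-cocycle that is not a coboundary, over every ring, and [m = 7] is treated
   the same way for the full complex.  Reduced homology only enters through
   degrees 0 and 1, where it is compared with locally constant functions and
   with 1-cocycles. *)

(** * Simplicial complexes *)

Section Complexes.
Variable T : finType.
Implicit Types (D : {set {set T}}) (A B F H : {set T}).

Definition down_closed D := forall A B, A \subset B -> B \in D -> A \in D.

Lemma dsize_leP D n :
  reflect (forall F, F \in D -> #|F| <= n) (dsize D <= n).
Proof. exact: bigmax_leqP. Qed.

Lemma leq_dsize D F n : F \in D -> n <= #|F| -> n <= dsize D.
Proof.
move=> FD /leq_trans; apply.
rewrite /dsize; exact: leq_bigmax_cond.
Qed.

Lemma dsize_gt D n : n < dsize D -> exists2 F, F \in D & n < #|F|.
Proof.
move=> nD; apply/exists_inP; apply: contraLR nD => /exists_inPn small.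
by rewrite -leqNgt; apply/dsize_leP => F /small; rewrite -leqNgt.
Qed.

Lemma in_facets D F : F \in facets D ->
  F \in D /\ forall H, H \in D -> F \subset H -> H = F.
Proof.
rewrite inE => /andP[FD /forall_inP max]; split=> // H HD FH.
by have /implyP/(_ FH)/eqP := max H HD.
Qed.

Lemma facetsI D F : F \in D -> (forall H, H \in D -> F \subset H -> H = F) ->
  F \in facets D.
Proof.
move=> FD max; rewrite inE FD; apply/forall_inP => H HD.
by apply/implyP => /(max H HD)->.
Qed.

Lemma facet_above D A : A \in D -> exists2 F, F \in facets D & A \subset F.
Proof.
move=> AD.
have P0 : (A \in D) && (A \subset A) by rewrite AD subxx.
have [F /maxsetP[/andP[FD _] max] AF] :=
  maxset_exists (P := fun F => (F \in D) && (A \subset F)) P0.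
exists F => //; apply: facetsI => // H HD FH.
by apply: max => //; rewrite HD (subset_trans AF FH).
Qed.

Lemma facet_big D n F : F \in D -> (forall H, H \in D -> #|H| <= n) ->
  n <= #|F| -> F \in facets D.
Proof.
move=> FD small nF; apply: facetsI => // H HD FH; apply/eqP.
by rewrite eq_sym eqEcard FH (leq_trans (small H HD)).
Qed.

Lemma pure_eq_card D n :
  (forall A, A \in D -> exists2 H, H \in D & A \subset H /\ #|H| = n) -> pure D.
Proof.
move=> ext; suff card F : F \in facets D -> #|F| = n.
  by move=> F H /card-> /card->.
by case/in_facets=> FD max; have [H HD [FH <-]] := ext F FD; rewrite (max H).
Qed.

Lemma pure_dsize D F : pure D -> F \in facets D -> #|F| = dsize D.
Proof.
move=> purD FD; apply/eqP; rewrite eqn_leq; case/in_facets: (FD) => FD' _.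
rewrite (leq_dsize FD') //=; apply/dsize_leP => H /facet_above[H' H'D HH'].
by rewrite (purD F H' FD H'D) subset_leq_card.
Qed.

Lemma link_closed D F : down_closed D -> down_closed (link D F).
Proof.
move=> cl A B AB; rewrite !inE => /and3P[BD dBF BF]; apply/and3P; split.
- exact: cl AB BD.
- exact: disjointWl AB dBF.
- by apply: cl BF; apply: setSU.
Qed.

Lemma deletion_closed D F : down_closed D -> down_closed (deletion D F).
Proof.
move=> cl A B AB; rewrite !inE => /andP[BD dBF].
by rewrite (cl A B) //= (disjointWl AB dBF).
Qed.

Lemma pure_skeleton_closed D k : down_closed D -> down_closed (pure_skeleton D k).
Proof.
move=> cl A B AB; rewrite !inE => /andP[BD /exists_inP[H HD /andP[kH BH]]].
rewrite (cl A B) //=; apply/exists_inP; exists H => //.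
by rewrite kH (subset_trans AB).
Qed.

Lemma sub_pure_skeleton D k : pure_skeleton D k \subset D.
Proof. by apply/subsetP => A; rewrite inE => /andP[]. Qed.

Lemma pure_skeletonP D k A : down_closed D ->
  reflect (exists2 H, H \in D & #|H| = k /\ A \subset H) (A \in pure_skeleton D k).
Proof.
move=> cl; rewrite inE; apply: (iffP andP).
  by case=> _ /exists_inP[H HD /andP[/eqP kH AH]]; exists H.
case=> H HD [kH AH]; split; first exact: cl HD.
by apply/exists_inP; exists H; rewrite ?kH ?eqxx.
Qed.

Lemma link0 D : down_closed D -> link D set0 = D.
Proof.
move=> cl; apply/setP => A; rewrite inE setU0.
by rewrite -setI_eq0 setI0 eqxx andbb.
Qed.

(** Makes a bad link at a face through a vertex reappear inside the link of that vertex, where the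
    Buchsbaum condition looks for it. *)
Lemma link_link D A B : down_closed D -> [disjoint A & B] ->
  link (link D A) B = link D (A :|: B).
Proof.
move=> cl dAB; apply/setP => H; rewrite !inE.
have -> : [disjoint H & A :|: B] = [disjoint H & A] && [disjoint H & B].
  by rewrite -!setI_eq0 setIUr setU_eq0.
have -> : [disjoint H :|: B & A] = [disjoint H & A].
  by move: dAB; rewrite -!setI_eq0 setIUl setU_eq0 setIC => ->; rewrite andbT.
rewrite setUA [H :|: B :|: A]setUAC.
case: [disjoint H & A]; rewrite ?andbF //=.
case: [disjoint H & B]; rewrite ?andbF //=.
have [HABD|] := boolP (H :|: A :|: B \in D); last by rewrite ?andbF.
rewrite (cl H _ _ HABD) ?(cl (H :|: A) _ _ HABD) ?(cl (H :|: B) _ _ HABD) //.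
- by rewrite setSU // subsetUl.
- exact: subsetUl.
- by rewrite -setUA subsetUl.
Qed.

Lemma dsize_link_add D F n :
  n < dsize (link D F) -> exists2 H, H \in D & n + #|F| < #|H|.
Proof.
case/dsize_gt => H; rewrite inE => /and3P[_ dHF HFD] nH.
by exists (H :|: F) => //; rewrite cardsU disjoint_setI0 // cards0 subn0 ltn_add2r.
Qed.

End Complexes.

(** * Connectedness through locally constant functions *)

Section Connectedness.
Variable T : finType.
Implicit Types (D : {set {set T}}) (A B F H : {set T}).

(** A function constant on edges is constant along paths. Disconnectedness is always refuted with
    such an invariant: the copy index, a parity, or the test for one vertex. *)
Lemma connected_const (R : eqType) D (w : T -> R) : connected_complex D ->
  (forall x y, [set x; y] \in D -> w x = w y) ->
  forall x y, [set x] \in D -> [set y] \in D -> w x = w y.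
Proof.
move=> conn loc x y xD yD; have /connectP[p] := conn x y xD yD.
elim: p x {xD} => [|z p IHp] x /=; first by move=> _ ->.
by case/andP=> /loc-> /IHp.
Qed.

(** The indicator of the component of a vertex is itself constant on edges. *)
Lemma const_connected D :
  (forall w : pred T, (forall x y, [set x; y] \in D -> w x = w y) ->
     forall x y, [set x] \in D -> [set y] \in D -> w x = w y) ->
  connected_complex D.
Proof.
move=> const u v uD vD; set e := fun a b => _.
have symE : connect_sym e by apply: sym_connect_sym => x y; rewrite /e setUC.
rewrite -(const (connect e u) _ u v) ?connect0 // => x y xy.
exact: (same_connect_r symE) (connect1 xy) u.
Qed.

(** A later facet shares all but one of its vertices with some earlier facet. As it has at least two
    vertices, a shared one carries the value of [w] back to the first facet by strong induction. *)
Lemma shellable_connected D :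
  down_closed D -> shellable D -> 2 <= dsize D -> connected_complex D.
Proof.
move=> cl [purD [s [us sD sh]]] D2; apply: const_connected => w loc.
have facE i : i < size s -> nth set0 s i \in facets D.
  by move=> lt_i; rewrite -sD inE mem_nth.
have inF i x y : i < size s -> x \in nth set0 s i -> y \in nth set0 s i -> w x = w y.
  move=> lt_i xF yF; apply/loc/(cl _ (nth set0 s i)).
    by apply/subsetP => z; rewrite !inE => /orP[/eqP->|/eqP->].
  by case/in_facets: (facE i lt_i).
have all0 i : i < size s -> forall x y,
    x \in nth set0 s i -> y \in nth set0 s 0 -> w x = w y.
  elim/ltn_ind: i => i IH lt_i x y xi y0.
  case: (posnP i) => [i0|i_gt0]; first by apply: (inF i); rewrite // i0.
  have [v [_ [k [lt_ki Fik]]]] := sh i 0 (introT andP (conj i_gt0 lt_i)).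
  have [z zi zv] : exists2 z, z \in nth set0 s i & z != v.
    have := D2; rewrite -(pure_dsize purD (facE i lt_i)) (cardD1 v).
    case: (pickP [predD1 (nth set0 s i) & v]) => [z /andP[zv zi] _|none].
      by exists z.
    by rewrite (eq_card0 none); case: (v \in _).
  rewrite (inF i x z) // (IH k lt_ki (ltn_trans lt_ki lt_i) z y) //.
  by apply: contraR zv => zk; rewrite -in_set1 -Fik inE zk.
have inS x : [set x] \in D -> exists2 i, i < size s & x \in nth set0 s i.
  case/facet_above => F; rewrite -sD inE => Fs xF.
  exists (index F s); first by rewrite index_mem.
  by rewrite nth_index // -sub1set.
have [|[y y0]] := set_0Vmem (nth set0 s 0).
  move=> s0 x y /inS[i lt_i _] _; have lt0 : 0 < size s by apply: leq_ltn_trans lt_i.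
  by have := pure_dsize purD (facE 0 lt0); rewrite s0 cards0 => D0; rewrite -D0 in D2.
by move=> x z /inS[i lt_i xi] /inS[j lt_j zj]; rewrite (all0 i lt_i x y xi y0) (all0 j lt_j z y).
Qed.

Lemma vertex_decomposable_pure D : vertex_decomposable D -> pure D.
Proof. by case. Qed.

(** If some facet avoids [x], purity keeps two vertices per facet in the deletion, which is
    connected by induction, and a facet through [x] attaches [x] to it. Otherwise [x] lies in every
    facet and is joined to every vertex. *)
Lemma vertex_decomposable_connected D :
  vertex_decomposable D -> down_closed D -> 2 <= dsize D -> connected_complex D.
Proof.
elim=> {}D => [_ [F ->] _ _ u v|x purD xD _ _ _ IH cl D2].
  rewrite !inE !sub1set => uF vF; apply: connect1.
  by rewrite inE subUset !sub1set uF.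
apply: const_connected => w loc.
have [[H HD xH]|allx] : (exists2 H, H \in facets D & x \notin H)
    \/ (forall H, H \in facets D -> x \in H).
  case: (boolP [exists H in facets D, x \notin H]) => [/exists_inP|/exists_inPn] e.
    by left; case: e => H; exists H.
  by right=> H /e; rewrite negbK.
  have cardH := pure_dsize purD HD; case/in_facets: HD => HD _.
  have del2 : 2 <= dsize (deletion D [set x]).
    by apply: (@leq_dsize _ _ H); rewrite ?cardH // inE HD disjoint_sym disjoints1.
  have delw a b : [set a] \in D -> [set b] \in D -> a != x -> b != x -> w a = w b.
    move=> aD bD ax bx.
    apply: (connected_const (IH (deletion_closed cl) del2)) => [c d||].
    - by rewrite inE => /andP[/loc].
    - by rewrite inE aD disjoints1 inE.
    - by rewrite inE bD disjoints1 inE.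
  have [F /[dup] /(pure_dsize purD) cardF] := facet_above xD.
  case/in_facets=> FD _; rewrite sub1set => xF.
  have [y yF yx] : exists2 y, y \in F & y != x.
    have := D2; rewrite -cardF (cardD1 x) xF ltnS => /card_gt0P[y].
    by rewrite !inE => /andP[]; exists y.
  have yD : [set y] \in D by apply: cl FD; rewrite sub1set.
  have xy : w x = w y by apply/loc/(cl _ F); rewrite // subUset !sub1set xF.
  move=> a b aD bD; have [->|ax] := eqVneq a x; have [->|bx] := eqVneq b x => //.
  - by rewrite xy; apply: delw.
  - by rewrite xy; apply: delw.
  - exact: delw.
move=> a b aD bD; suff wx c : [set c] \in D -> w c = w x by rewrite !wx.
case/facet_above=> F FD cF; apply/loc/(cl _ F); last by case/in_facets: FD.
by rewrite subUset cF sub1set allx.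
Qed.

(* [H^1 = 0], with cochains as functions on ordered pairs so that no orientation
   of the faces enters; taking [x = y] forces [c x x = 0] and antisymmetry. *)
Definition acyclic1 (R : zmodType) D :=
  forall c : T -> T -> R,
    (forall H, H \in D ->
       {in H & &, forall x y z, c x y + c y z = c x z}%R) ->
  exists w : T -> R,
    forall H, H \in D -> {in H &, forall x y, c x y = w y - w x}%R.

End Connectedness.

(** * Shellability and 1-cocycles *)

Section ShellableAcyclic.
Variables (T : finType) (R : zmodType).
Implicit Types (D : {set {set T}}) (F H : {set T}).

(** The potential [w] is extended facet by facet along the shelling. The point is that on the
    vertices of the new facet seen before, [w] already agrees with [c]; this uses that facets have
    at least three vertices. *)
Lemma shellable_acyclic1 D :
  down_closed D -> shellable D -> 3 <= dsize D -> acyclic1 R D.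
Proof.
move=> cl [purD [s [us sD sh]]] D3 c cocyc.
have facE i : i < size s -> nth set0 s i \in facets D.
  by move=> lt_i; rewrite -sD inE mem_nth.
have coc i : i < size s ->
    {in nth set0 s i & &, forall x y z, c x y + c y z = c x z}%R.
  by move=> lt_i; apply: cocyc; case/in_facets: (facE i lt_i).
suff step n : n <= size s -> exists w : T -> R, forall i, i < n ->
    {in nth set0 s i &, forall x y, c x y = w y - w x}%R.
  have [w wP] := step _ (leqnn _); exists w => H /facet_above[F].
  rewrite -sD inE => Fs /subsetP HF x y xH yH; apply: (wP (index F s)).
  - by rewrite index_mem.
  - by rewrite nth_index // HF.
  - by rewrite nth_index // HF.
elim: n => [|n IHn] lt_n; first by exists (fun=> 0%R).
have [w wP] := IHn (ltnW lt_n); set F := nth set0 s n.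
pose old := [pred v | [exists k : 'I_n, v \in nth set0 s k]].
(* Shelling against a facet [j] through [v] yields a removed vertex outside facet [j], hence
   different from [v]; so facet [k] still contains [v]. *)
have oldP v : v \in F -> v \in old ->
    exists k x, [/\ k < n, v \in nth set0 s k & F :\: nth set0 s k = [set x]].
  move=> vF /existsP[j vj].
  have [x [xFj [k [lt_k Fk]]]] := sh n j (introT andP (conj (ltn_ord j) lt_n)).
  exists k, x; split=> //; apply: contraLR vj => vk.
  have : v \in F :\: nth set0 s k by rewrite inE vk.
  by rewrite Fk inE => /eqP->; move: xFj; rewrite inE => /andP[].
have cc x : x \in F -> c x x = 0%R.
  by move=> xF; apply: (addrI (c x x)); rewrite addr0 (coc n).
have old_old a b : a \in F -> b \in F -> a \in old -> b \in old ->
    c a b = (w b - w a)%R.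
  move=> aF bF /(oldP a aF)[k1 [x1 [lt1 ak1 F1]]] /(oldP b bF)[k2 [x2 [lt2 bk2 F2]]].
  (* [F] has a third vertex besides [x1] and [x2]; it lies in both earlier facets, and [c a b] is
     split at it. *)
  have [z zF] : exists2 z, z \in F & (z != x1) && (z != x2).
    have := D3; rewrite -(pure_dsize purD (facE n lt_n)) -/F.
    have -> : #|F| = #|F :&: [set x1; x2]| + #|F :\: [set x1; x2]| by rewrite cardsID.
    have le2 : #|F :&: [set x1; x2]| <= 2.
      by rewrite (leq_trans (subset_leq_card (subsetIr _ _))) // cards2 ltnS leq_b1.
    move=> F3; have /card_gt0P[z] : 0 < #|F :\: [set x1; x2]| by lia.
    by rewrite !inE negb_or => /andP[]; exists z.
  case/andP=> zx1 zx2.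
  have zk1 : z \in nth set0 s k1.
    by apply: contraR zx1 => zk; rewrite -in_set1 -F1 inE zk.
  have zk2 : z \in nth set0 s k2.
    by apply: contraR zx2 => zk; rewrite -in_set1 -F2 inE zk.
  rewrite -(coc n lt_n a z b) // (wP k1) // (wP k2) //.
  by rewrite addrC addrA addrNK.
(* A new potential that leaves the old vertices alone stays valid on the earlier facets. *)
have extend (w' : T -> R) : {in old, w' =1 w} ->
    {in F &, forall x y, c x y = w' y - w' x}%R -> exists w : T -> R, forall i,
    i < n.+1 -> {in nth set0 s i &, forall x y, c x y = w y - w x}%R.
  move=> w'w w'F; exists w' => i; rewrite ltnS leq_eqVlt => /predU1P[-> //|lt_i].
  have io x : x \in nth set0 s i -> x \in old.
    by move=> xi; apply/existsP; exists (Ordinal lt_i).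
  by move=> x y xi yi; rewrite !w'w ?io // (wP i).
(* With an old vertex [z] in [F], new vertices get their potential from [z]; without one, any vertex
   of [F] can be the base point. *)
have [/exists_inP[z zF zo]|/exists_inPn none] := boolP [exists z in F, z \in old].
  apply: (extend (fun v => if v \in old then w v else w z + c z v)%R) => [v -> //|].
  have eqw v : v \in F -> (if v \in old then w v else (w z + c z v)%R) = (w z + c z v)%R.
    by move=> vF; case: ifP => // vo; rewrite (old_old z v) // addrC subrK.
  move=> x y xF yF; rewrite !eqw // -(coc n lt_n z x y) //.
  by rewrite opprD addrACA subrr add0r addrAC subrr add0r.
have [F0|[z zF]] := set_0Vmem F.
  by apply: (extend w) => // x y; rewrite F0 inE.
apply: (extend (fun v => if v \in old then w v else c z v)%R) => [v -> //|x y xF yF].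
rewrite (negbTE (none x xF)) (negbTE (none y yF)) -(coc n lt_n z x y) //.
by rewrite addrAC subrr add0r.
Qed.

End ShellableAcyclic.

(** * Homology in low degrees *)

Section Homology.
Variables (T : finType) (K : fieldType).
Implicit Types (D : {set {set T}}) (A F H : {set T}).
Local Open Scope ring_scope.

(** Row vectors, because the rows of [bnd] are indexed by the smaller faces: multiplying by [bnd] on
    the right is then the coboundary. *)
Definition cochain D k (f : {set T} -> K) : 'rV[K]_#|faces D k| :=
  \row_i f (enum_val i).

Lemma cochain_eq D k f g :
  (forall F, F \in D -> #|F| = k -> f F = g F) -> cochain D k f = cochain D k g.
Proof.
move=> fg; apply/rowP => i; rewrite !mxE.
by have := enum_valP i; rewrite inE => /andP[FD /eqP]; apply: fg.
Qed.

Lemma cochain_inj D k f g : cochain D k f = cochain D k g ->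
  forall F, F \in D -> #|F| = k -> f F = g F.
Proof.
move=> /rowP fg F FD kF.
have Fk : F \in faces D k by rewrite inE FD kF eqxx.
by have := fg (enum_rank_in Fk F); rewrite !mxE enum_rankK_in.
Qed.

Lemma cochain_surj D k (u : 'rV[K]_#|faces D k|) : exists f, u = cochain D k f.
Proof.
exists (fun F => if [pick i | enum_val i == F] is Some i then u 0 i else 0).
apply/rowP => i; rewrite mxE; case: pickP => [j /eqP/enum_val_inj-> //|/(_ i)].
by rewrite eqxx.
Qed.

Definition vsign F (v : T) : K :=
  (-1) ^+ #|[set u in F | (enum_rank u < enum_rank v)%N]|.

Definition coboundary (f : {set T} -> K) F := \sum_(v in F) f (F :\ v) * vsign F v.

(** After exchanging the sums over the subfaces [G] and the vertices [v] of [F] outside [G], only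
    [G = F :\ v] remains, by cardinality. *)
Lemma cochain_bnd D k f : down_closed D ->
  cochain D k f *m bnd K D k = cochain D k.+1 (coboundary f).
Proof.
move=> cl; apply/rowP => j; rewrite !mxE /coboundary.
have := enum_valP j; set F : {set T} := enum_val j; rewrite inE => /andP[FD /eqP kF].
transitivity (\sum_(G in faces D k | G \subset F) \sum_(v in F :\: G) f G * vsign F v).
  rewrite big_mkcondr /= [RHS]big_enum_val; apply: eq_bigr => i _; rewrite !mxE.
  rewrite /= -/F; case: ifP => _; rewrite ?mulr0 ?mulr_sumr //.
rewrite (exchange_big_dep (fun v => v \in F)) /= => [|G v _ /setDP[] //].
apply: eq_bigr => v vF; rewrite (big_pred1 (F :\ v)) // => G.
have kD : #|F :\ v| = k by have := cardsD1 v F; rewrite vF kF add1n => -[].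
rewrite [LHS]/= !inE; apply/idP/eqP => [|->]; last first.
  by rewrite (cl (F :\ v) F) ?subD1set // kD !inE vF !eqxx.
case/andP=> /andP[/andP[_ /eqP kG] GF] /andP[vG _]; apply/eqP.
by rewrite eqEcard subsetD1 GF vG kG kD /=.
Qed.

Lemma vsignE F v A : A \subset F ->
  (forall u, u \in F -> (enum_rank u < enum_rank v)%N = (u \in A)) ->
  vsign F v = (-1) ^+ #|A|.
Proof.
move=> AF lt_v; rewrite /vsign; congr (_ ^+ _); apply: eq_card => u.
by rewrite inE; have [/lt_v//|uF] := boolP (u \in F); apply/esym/(contraNF _ uF)/subsetP.
Qed.

Lemma coboundary1 f x : coboundary f [set x] = f set0.
Proof.
rewrite /coboundary big_set1 setDv (vsignE (A := set0)) ?sub0set ?cards0 ?mulr1 //.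
by move=> u /set1P->; rewrite ltnn inE.
Qed.

Lemma neq_enum_rank (a b : T) : (enum_rank a < enum_rank b)%N ->
  [/\ (a == b) = false, (b == a) = false & (enum_rank b < enum_rank a)%N = false].
Proof.
move=> ab; split; last by rewrite ltnNge ltnW.
- by apply: contraTF ab => /eqP->; rewrite ltnn.
- by apply: contraTF ab => /eqP->; rewrite ltnn.
Qed.

Lemma coboundary2 f x y : (enum_rank x < enum_rank y)%N ->
  coboundary f [set x; y] = f [set y] - f [set x].
Proof.
move=> lt_xy; have [xy yx ge_xy] := neq_enum_rank lt_xy.
rewrite /coboundary big_setU1 ?inE ?xy //= big_set1.
rewrite (vsignE (A := set0)) ?sub0set //; last first.
  by move=> u /set2P[]->; rewrite ?ltnn ?ge_xy inE.
rewrite (vsignE (A := [set x])) ?sub1set ?set21 //; last first.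
  by move=> u /set2P[]->; rewrite ?ltnn ?lt_xy inE ?yx ?eqxx.
have -> : [set x; y] :\ x = [set y] by rewrite setU1K ?inE ?xy.
have -> : [set x; y] :\ y = [set x] by rewrite setUC setU1K ?inE ?yx.
by rewrite cards0 cards1 mulr1 expr1 mulrN1.
Qed.

Lemma coboundary3 f x y z :
  (enum_rank x < enum_rank y)%N -> (enum_rank y < enum_rank z)%N ->
  coboundary f [set x; y; z] = f [set y; z] - f [set x; z] + f [set x; y].
Proof.
move=> lt_xy lt_yz; have lt_xz := ltn_trans lt_xy lt_yz.
have [xy yx ge_xy] := neq_enum_rank lt_xy.
have [yz zy ge_yz] := neq_enum_rank lt_yz.
have [xz zx ge_xz] := neq_enum_rank lt_xz.
have cmp := (lt_xy, lt_yz, lt_xz, ge_xy, ge_yz, ge_xz, ltnn).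
have ne := (xy, yx, yz, zy, xz, zx, eqxx).
rewrite /coboundary [\sum_(v in _) _](_ : _ =
    \sum_(v in x |: (y |: [set z])) f ([set x; y; z] :\ v) * vsign [set x; y; z] v);
  last by rewrite setUA.
rewrite big_setU1 ?inE ?ne //= big_setU1 ?inE ?ne //= big_set1.
have memP u : u \in [set x; y; z] -> [\/ u = x, u = y | u = z].
  by rewrite !inE -orbA => /or3P[]/eqP->; [constructor 1|constructor 2|constructor 3].
rewrite (vsignE (A := set0)) ?sub0set //; last first.
  by move=> u /memP[]->; rewrite !cmp inE.
rewrite (vsignE (A := [set x])) ?sub1set ?inE ?ne //; last first.
  by move=> u /memP[]->; rewrite !cmp inE !ne.
rewrite (vsignE (A := [set x; y])) ?subsetUl //; last first.
  by move=> u /memP[]->; rewrite !cmp !inE !ne.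
have -> : [set x; y; z] :\ x = [set y; z] by rewrite -setUA setU1K ?inE ?ne.
have -> : [set x; y; z] :\ y = [set x; z].
  by rewrite [[set x; y]]setUC -setUA setU1K ?inE ?ne.
have -> : [set x; y; z] :\ z = [set x; y] by rewrite setUC setU1K ?inE ?ne.
by rewrite cards0 cards1 cards2 xy mulr1 expr1 expr2 !mulrN1 opprK mulr1 addrA.
Qed.

(** The row space of [bnd K D k] lies in the left kernel of [bnd K D k.+1]. A zero Betti number,
    being a truncated difference, bounds the rank of this kernel by that of the row space, so the
    two agree and every cocycle is a coboundary. *)
Lemma rank_bnd_lt D k (u : 'rV_#|faces D k.+1|) :
  bnd K D k *m bnd K D k.+1 = 0 -> u *m bnd K D k.+1 = 0 ->
  rbetti K D k.+1 = 0%N -> (u <= bnd K D k)%MS.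
Proof.
move=> /sub_kermxP bb /sub_kermxP uk; rewrite /rbetti => r0.
apply: submx_trans uk _; have := mxrank_leqif_sup bb.
rewrite mxrank_ker => -[le eqr]; rewrite -eqr eqn_leq le /=.
by move/eqP: r0; rewrite subnAC subn_eq0.
Qed.

Lemma edge_ordered (E : {set T}) : #|E| = 2 ->
  exists x y, E = [set x; y] /\ (enum_rank x < enum_rank y)%N.
Proof.
move=> /eqP/cards2P[x [y [xy ->]]].
case: (ltngtP (enum_rank x) (enum_rank y)) => [lt|lt|/val_inj/enum_rank_inj e].
- by exists x, y.
- by exists y, x; rewrite setUC.
- by rewrite e eqxx in xy.
Qed.

Lemma triangle_ordered (E : {set T}) : #|E| = 3 ->
  exists x y z, [/\ E = [set x; y; z], (enum_rank x < enum_rank y)%N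
                 & (enum_rank y < enum_rank z)%N].
Proof.
move=> E3; have /card_gt0P[v vE] : (0 < #|E|)%N by rewrite E3.
have [|x [y [Exy lt_xy]]] := @edge_ordered (E :\ v).
  by have := cardsD1 v E; rewrite vE E3 add1n => -[].
have [xv yv] : x != v /\ y != v.
  have : x \in E :\ v by rewrite Exy set21.
  have : y \in E :\ v by rewrite Exy set22.
  by rewrite !inE => /andP[-> _] /andP[-> _].
have Ev : E = v |: [set x; y] by rewrite -Exy setD1K.
have rank_neq (a b : T) : a != b ->
      ((enum_rank a < enum_rank b) || (enum_rank b < enum_rank a))%N.
  by move=> ab; rewrite -neq_ltn (inj_eq val_inj) (inj_eq enum_rank_inj).
case/orP: (rank_neq _ _ xv) => [lt_xv|lt_vx]; last first.
  by exists v, x, y; rewrite Ev setUA.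
case/orP: (rank_neq _ _ yv) => [lt_yv|lt_vy].
  by exists x, y, v; rewrite Ev setUC.
by exists x, v, y; rewrite Ev setUA [[set v; x]]setUC.
Qed.

Lemma cochain0 D k f : (forall F, F \in D -> #|F| = k -> f F = 0) ->
  cochain D k f = 0.
Proof. by move/(cochain_eq (g := fun=> 0))->; apply/rowP => i; rewrite !mxE. Qed.

Lemma bnd_mul0 D k : down_closed D ->
  (forall f F, F \in D -> #|F| = k.+2 -> coboundary (coboundary f) F = 0) ->
  bnd K D k *m bnd K D k.+1 = 0.
Proof.
move=> cl dd; apply/row_matrixP => i; rewrite row_mul row0 rowE.
have [f ->] := cochain_surj (delta_mx 0 i : 'rV[K]_#|faces D k|).
by rewrite !cochain_bnd // cochain0 // => F FD /(dd f _ FD).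
Qed.

Lemma bnd01 D : down_closed D -> bnd K D 0 *m bnd K D 1 = 0.
Proof.
move=> cl; apply: bnd_mul0 => // f F _ /edge_ordered[x [y [-> lt_xy]]].
by rewrite coboundary2 // !coboundary1 subrr.
Qed.

Lemma bnd12 D : down_closed D -> bnd K D 1 *m bnd K D 2 = 0.
Proof.
move=> cl; apply: bnd_mul0 => // f F _ /triangle_ordered[x [y [z [-> lt_xy lt_yz]]]].
by rewrite coboundary3 // !coboundary2 // ?(ltn_trans lt_xy lt_yz) //; ring.
Qed.

(** The empty face is the only one of size 0, and the coboundary of the constant 1 does not vanish
    at [v]. *)
Lemma rbetti0 D v : down_closed D -> [set v] \in D -> rbetti K D 0 = 0%N.
Proof.
move=> cl vD; rewrite /rbetti subn0; apply/eqP; rewrite subn_eq0.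
have le1 : (#|faces D 0| <= 1)%N.
  rewrite -(cards1 (set0 : {set T})); apply/subset_leq_card/subsetP => F.
  by rewrite !inE cards_eq0 => /andP[].
apply: leq_trans le1 _; rewrite lt0n mxrank_eq0; apply/eqP => b0.
have := cochain_bnd 0 (fun=> 1) cl; rewrite b0 mulmx0.
rewrite -(@cochain0 D 1 (fun=> 0)) // => /esym/cochain_inj/(_ _ vD (cards1 v)).
by rewrite coboundary1 => /eqP; rewrite oner_eq0.
Qed.

(** A cocycle on the vertices has equal values at the ends of each edge, so it is constant and comes
    from a value on the empty face. *)
Lemma rbetti1 D : down_closed D -> connected_complex D -> rbetti K D 1 = 0%N.
Proof.
move=> cl conn; rewrite /rbetti subnAC; apply/eqP; rewrite subn_eq0 -mxrank_ker.
apply: mxrankS; apply/row_subP => i.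
have [f fE] := cochain_surj (row i (kermx (bnd K D 1))).
have : row i (kermx (bnd K D 1)) *m bnd K D 1 = 0 by apply/sub_kermxP/row_sub.
rewrite fE cochain_bnd // -(@cochain0 D 2 (fun=> 0)) // => /cochain_inj f0.
have loc x y : [set x; y] \in D -> f [set x] = f [set y].
  move=> xyD; have [->//|xy] := eqVneq x y.
  have E2 : #|[set x; y]| = 2 by rewrite cards2 xy.
  have [a [b [Eab lt_ab]]] := edge_ordered E2.
  have fab : f [set a] = f [set b].
    by have := f0 _ xyD E2; rewrite Eab coboundary2 // => /subr0_eq.
  have ends v : v \in [set x; y] -> f [set v] = f [set b].
    by rewrite Eab => /set2P[]->.
  by rewrite !ends ?set21 ?set22.
have const := connected_const (w := fun v => f [set v]) conn loc.
(* The common value on the vertices; the default 0 covers a complex without vertices. *)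
pose c := if [pick v | [set v] \in D] is Some v then f [set v] else 0.
apply/submxP; exists (cochain D 0 (fun=> c)); rewrite cochain_bnd //.
apply: cochain_eq => F FD /eqP/cards1P[v Fv]; rewrite {F}Fv in FD *.
rewrite coboundary1 /c; case: pickP => [u uD|/(_ v)]; last by rewrite FD.
exact: const.
Qed.

(** A locally constant predicate gives a cocycle with values 0 and 1. It is the coboundary of a
    value on the empty face, hence constant, and 0 differs from 1 in [K]. *)
Lemma rbetti1_connected D : down_closed D -> rbetti K D 1 = 0%N -> connected_complex D.
Proof.
move=> cl r1; apply: const_connected => w loc x y xD yD.
pose f F : K := [exists v in F, w v]%:R.
have f1 v : f [set v] = (w v)%:R.
  congr (_%:R); congr nat_of_bool; apply/exists_inP/idP => [[u /set1P->]//|wv].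
  by exists v; rewrite ?set11.
have : cochain D 1 f *m bnd K D 1 = 0.
  rewrite cochain_bnd // cochain0 // => F FD /edge_ordered[a [b [Fab lt_ab]]].
  by rewrite Fab coboundary2 // !f1 (loc a b) ?subrr // -Fab.
case/(rank_bnd_lt (bnd01 cl))/(_ r1)/submxP => u.
have [g ->] := cochain_surj u; rewrite cochain_bnd // => /cochain_inj fg.
have : (w x)%:R = (w y)%:R :> K by rewrite -!f1 !fg ?cards1 // !coboundary1.
by case: (w x) (w y) => [] [] // /eqP; rewrite ?oner_eq0 // eq_sym oner_eq0.
Qed.

Lemma rbetti2_acyclic1 D : down_closed D -> rbetti K D 2 = 0%N -> acyclic1 K D.
Proof.
move=> cl r2 c cocyc.
(* On a two-element set the double sum picks [c] at the increasing pair, the orientation used by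
   [bnd]. Decreasing pairs are recovered at the end from antisymmetry. *)
pose f F := \sum_(x in F) \sum_(y in F | (enum_rank x < enum_rank y)%N) c x y.
have f2 x y : (enum_rank x < enum_rank y)%N -> f [set x; y] = c x y.
  move=> lt_xy; have [xy yx ge_xy] := neq_enum_rank lt_xy.
  rewrite /f big_setU1 ?inE ?xy //= big_set1 (big_pred1 y) => [|u].
    rewrite big_pred0 ?addr0 // => u; rewrite !inE; apply/negP => /andP[/orP[]/eqP->].
      by rewrite ge_xy.
    by rewrite ltnn.
  rewrite /= !inE; have [->|_] := eqVneq u x; first by rewrite ltnn xy.
  by have [->|] := eqVneq u y; rewrite ?lt_xy.
have : cochain D 2 f *m bnd K D 2 = 0.
  rewrite cochain_bnd // cochain0 // => F FD /triangle_ordered[x [y [z [Fxyz lt1 lt2]]]].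
  rewrite {1}Fxyz coboundary3 // !f2 ?(ltn_trans lt1 lt2) //.
  rewrite -(cocyc _ FD x y z) ?Fxyz ?inE ?eqxx ?orbT //; ring.
case/(rank_bnd_lt (bnd12 cl))/(_ r2)/submxP => u.
have [g ->] := cochain_surj u; rewrite cochain_bnd // => /cochain_inj fg.
have cE x y : [set x; y] \in D -> (enum_rank x < enum_rank y)%N ->
    c x y = g [set y] - g [set x].
  move=> xyD lt_xy; have [xy _ _] := neq_enum_rank lt_xy.
  by rewrite -f2 // fg ?cards2 ?xy // coboundary2.
exists (fun v => g [set v]) => H HD x y xH yH.
have c0 v : v \in H -> c v v = 0.
  by move=> vH; apply: (addrI (c v v)); rewrite addr0 (cocyc _ HD).
have HxyD : [set x; y] \in D.
  by apply: cl HD; apply/subsetP => v /set2P[]->.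
case: (ltngtP (enum_rank x) (enum_rank y)) => [lt|lt|/val_inj/enum_rank_inj->].
- exact: cE.
- apply/eqP; rewrite -subr_eq0 opprB addrC -(cE y x) 1?setUC //.
  by rewrite addrC (cocyc _ HD) ?c0.
- by rewrite c0 // subrr.
Qed.

(** The relevant degrees satisfy [k + #|F| < 2]. So either [k = 0], where a vertex of the link
    suffices, or [k = 1] and [F] is empty, where connectedness is needed. *)
Lemma CM_dsize2 D : down_closed D -> (dsize D <= 2)%N ->
  ((2 <= dsize D)%N -> connected_complex D) -> CM K D.
Proof.
move=> cl le2 conn F FD k lt_k; have clF := link_closed (F := F) cl.
have [H HD] := dsize_link_add lt_k; move: le2 => /dsize_leP/(_ H HD) H2 kFH.
case: k lt_k kFH => [|k] lt_k kFH.
  have [A AD /card_gt0P[v vA]] := dsize_gt lt_k.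
  by apply: (@rbetti0 _ v) => //; apply: clF AD; rewrite sub1set.
have [k0 F0] : k = 0 /\ #|F| = 0 by lia.
move/eqP: F0 lt_k; rewrite cards_eq0 k0 => /eqP->; rewrite link0 // => lt_k.
exact: rbetti1 (conn lt_k).
Qed.

Lemma CM_connected D : down_closed D -> CM K D -> set0 \in D -> (2 <= dsize D)%N ->
  connected_complex D.
Proof.
move=> cl cm D0 D2; apply: rbetti1_connected => //.
by have := cm _ D0 1; rewrite link0 // => ->.
Qed.

Lemma CM_acyclic1 D : down_closed D -> CM K D -> set0 \in D -> (3 <= dsize D)%N ->
  acyclic1 K D.
Proof.
move=> cl cm D0 D3; apply: rbetti2_acyclic1 => //.
by have := cm _ D0 2; rewrite link0 // => ->.
Qed.

End Homology.

(** * The join of cycles *)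

Section Shift.
Variables l m : nat.
Implicit Types x y z : 'I_(l * m).

Lemma lm_gt0 x : 0 < l /\ 0 < m.
Proof. by apply/andP; rewrite -muln_gt0; apply: leq_ltn_trans (ltn_ord x). Qed.

Lemma shift_subproof x d : x %% l + l * ((x %/ l + d) %% m) < l * m.
Proof.
have [l0 m0] := lm_gt0 x.
have := ltn_pmod x l0; have := ltn_pmod (x %/ l + d) m0; nia.
Qed.

(* The vertex [x = r + l * i] is vertex [i] of the [r]-th copy of the cycle;
   [shift x d] moves it [d] steps around its copy. *)
Definition shift x d : 'I_(l * m) := Ordinal (shift_subproof x d).

Lemma shift_mod x d : shift x d %% l = x %% l.
Proof. by rewrite /= addnC mulnC modnMDl modn_mod. Qed.

Lemma shift_div x d : shift x d %/ l = (x %/ l + d) %% m.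
Proof.
have [l0 _] := lm_gt0 x.
by rewrite /= addnC mulnC divnMDl // [x %% l %/ l]divn_small ?addn0 ?ltn_pmod.
Qed.

Lemma eq_mod_div x y : x %% l = y %% l -> x %/ l = y %/ l -> x = y.
Proof. by move=> xy1 xy2; apply: val_inj; rewrite /= (divn_eq x l) (divn_eq y l) xy1 xy2. Qed.

Lemma div_lt x : x %/ l < m.
Proof. by have [l0 _] := lm_gt0 x; rewrite ltn_divLR // [m * l]mulnC. Qed.

Lemma shift_shift x d e : shift (shift x d) e = shift x (d + e).
Proof.
apply: eq_mod_div; first by rewrite !shift_mod.
by rewrite !shift_div modnDml addnA.
Qed.

Lemma shift_modm x d : shift x (d %% m) = shift x d.
Proof.
apply: eq_mod_div; first by rewrite !shift_mod.
by rewrite !shift_div modnDmr.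
Qed.

Lemma shift_eq x d e : (shift x d == shift x e) = (d == e %[mod m]).
Proof.
apply/eqP/eqP => [/(congr1 (fun y : 'I_(l * m) => y %/ l))|de].
  by rewrite !shift_div => /eqP; rewrite eqn_modDl => /eqP.
by rewrite -shift_modm de shift_modm.
Qed.

Lemma shift0 x : shift x 0 = x.
Proof.
apply: eq_mod_div; first by rewrite !shift_mod.
by rewrite !shift_div addn0 modn_small ?div_lt.
Qed.

Lemma shiftm x : shift x m = x.
Proof. by rewrite -shift_modm modnn shift0. Qed.

Lemma same_copy x y : x %% l = y %% l -> exists2 d, d < m & y = shift x d.
Proof.
move=> xy; have [_ m0] := lm_gt0 x.
exists ((y %/ l + (m - x %/ l)) %% m); first by rewrite ltn_pmod.
rewrite shift_modm; apply: eq_mod_div; first by rewrite !shift_mod.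
have := div_lt x; have := div_lt y; rewrite shift_div => lty ltx.
have -> : x %/ l + (y %/ l + (m - x %/ l)) = y %/ l + m by lia.
by rewrite modnDr modn_small.
Qed.

Hypothesis m3 : 3 <= m.

(** For labels in different copies, [l] divides neither [d] nor [l * m - d]. In one copy [d] is [l]
    times a difference of positions, so the connection value [l] means cyclic distance 1. *)
Lemma joinGE x y :
  joinG l m x y = (x %% l != y %% l) || (y == shift x 1) || (x == shift y 1).
Proof.
have [l0 m0] := lm_gt0 x.
rewrite /joinG /circulant inE; set d := maxn x y - minn x y.
have lt_d : d < l * m by have := ltn_ord x; have := ltn_ord y; rewrite /d; lia.
have half : minn d (l * m - d) <= (l * m)./2 by lia.
rewrite half; have [rxy|rxy] /= := eqVneq (x %% l) (y %% l); last first.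
  have ld : ~~ (l %| d).
    apply: contra rxy; rewrite /d; case: (leqP x y) => le.
      by rewrite -eqn_mod_dvd // eq_sym.
    by rewrite -eqn_mod_dvd // ltnW.
  have lnd : ~~ (l %| l * m - d).
    by rewrite dvdn_subr ?dvdn_mulr // ltnW.
  have ne0 e : ~~ (l %| e) -> 0 < e by case: e; rewrite ?dvdn0.
  by case: (leqP d (l * m - d)) => _; rewrite ?(ld, lnd) orbT andbT ne0.
have ex : (x : nat) = x %/ l * l + x %% l := divn_eq x l.
have ey : (y : nat) = y %/ l * l + x %% l by rewrite rxy -divn_eq.
have dE : d = (maxn (x %/ l) (y %/ l) - minn (x %/ l) (y %/ l)) * l.
  by rewrite /d {1 2}ex {1 2}ey -addn_maxl -addn_minl subnDr -maxnMl -minnMl mulnBl.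
have shE (a b : 'I_(l * m)) : a %% l = b %% l -> (b == shift a 1) = (b %/ l == (a %/ l).+1 %% m).
  move=> ab; apply/eqP/eqP => [->|e]; first by rewrite shift_div addn1.
  by apply: eq_mod_div; rewrite ?shift_mod // shift_div addn1.
have minE e : minn (e * l) (l * m - e * l) = minn e (m - e) * l.
  by rewrite [l * m]mulnC -mulnBl -minnMl.
rewrite !shE // dE minE dvdn_mull // orbF muln_gt0 l0 andbT.
rewrite -[X in _ * _ == X]mul1n eqn_pmul2r //.
have := div_lt x; have := div_lt y; move: (x %/ l) (y %/ l) => i j lt_j lt_i.
clear - m3 lt_i lt_j.
have succ k : k < m -> k.+1 %% m = if k.+1 == m then 0 else k.+1.
  by move=> lt_k; case: eqP => [->|ne]; rewrite ?modnn // modn_small; lia.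
rewrite !succ //; clear succ.
case: (leqP i j) => le; case: (leqP (_ - _) (m - _)) => le';
  case: (eqVneq i.+1 m) => ei; case: (eqVneq j.+1 m) => ej; lia.
Qed.
End Shift.

(** * Independence complexes of graphs *)

Section Independent.
Variables (T : finType) (G : rel T).
Implicit Types (A B : {set T}).

Lemma indcomplexP A :
  reflect {in A &, forall u v, ~~ G u v} (A \in indcomplex G).
Proof.
rewrite inE; apply: (iffP forall_inP) => [ind u v uA vA|ind u uA].
  by have /forall_inP := ind u uA; apply.
by apply/forall_inP => v; apply: ind.
Qed.

Lemma indcomplex_closed : down_closed (indcomplex G).
Proof.
move=> A B /subsetP AB /indcomplexP ind; apply/indcomplexP => u v uA vA.
by apply: ind; apply: AB.
Qed.

Lemma set0_indcomplex : set0 \in indcomplex G.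
Proof. by apply/indcomplexP => u v; rewrite inE. Qed.

Lemma facets_indcomplex A : (A \in facets (indcomplex G)) = maximal_independent G A.
Proof.
rewrite inE /maximal_independent [in LHS]inE; congr (_ && _).
apply/forall_inP/forallP => [max B|max B].
  apply/implyP => /andP[AB nBA]; apply: contra nBA => indB.
  have BD : B \in indcomplex G by rewrite inE.
  by have /implyP/(_ AB)/eqP-> := max B BD.
rewrite inE => indB; apply/implyP => AB; apply: contraLR indB => nBA.
by have /implyP := max B; apply; rewrite properEneq AB eq_sym nBA.
Qed.

Lemma well_covered_pure : well_covered G <-> pure (indcomplex G).
Proof. by split=> wc A B; move: (wc A B); rewrite !facets_indcomplex. Qed.

Hypotheses (symG : symmetric G) (irrG : irreflexive G).

Lemma indcomplex_set1 x : [set x] \in indcomplex G.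
Proof. by apply/indcomplexP => u v /set1P-> /set1P->; rewrite irrG. Qed.

Lemma indcomplex_set2 x y : ([set x; y] \in indcomplex G) = ~~ G x y.
Proof.
apply/indcomplexP/idP => [|nxy u v]; first by apply; rewrite ?set21 ?set22.
by rewrite !inE => /orP[]/eqP-> /orP[]/eqP->; rewrite ?irrG // symG.
Qed.

(** Turns the Buchsbaum property into a condition on the links of vertices. *)
Lemma minus_nbhd_link x :
  indcomplex_minus_nbhd G x = link (indcomplex G) [set x].
Proof.
apply/setP => A; rewrite [LHS]inE [RHS]inE; have [/indcomplexP ind|//] /= := boolP (A \in _).
rewrite /closed_nbhd -!setI_eq0 setIUr setU_eq0; case: (A :&: [set x] == set0) => //=.
apply/idP/indcomplexP => [/eqP/setP no|ind'].
  have nG u : u \in A -> ~~ G x u.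
    by move=> uA; have := no u; rewrite !inE uA /= => ->.
  move=> u v /setUP[uA|/set1P->] /setUP[vA|/set1P->].
  - exact: ind.
  - by rewrite symG nG.
  - exact: nG.
  - by rewrite irrG.
apply/eqP/setP => u; rewrite !inE; apply/andP => -[uA].
by apply/negP/ind'; rewrite !inE ?eqxx ?uA ?orbT.
Qed.

End Independent.

(** Pair up consecutive positions: each pair holds at most one member. For odd [n] the position left
    over is [s + n.-1], which is excluded because its successor [s + n] is a member. *)
Lemma sparse_sum (b : pred nat) s n : (forall d, ~~ (b d && b d.+1)) -> b (s + n) ->
  \sum_(i < n) b (s + i) <= n./2.
Proof.
move=> sparse; elim/ltn_ind: n s => -[|[|n]] IH s bn; first by rewrite big_ord0.
  rewrite big_ord_recl big_ord0 addn0; have := sparse s.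
  by rewrite -addn1 bn andbT addn0; case: (b s).
rewrite 2!big_ord_recl /=; have /(_ s.+2) := IH n (ltnW (ltnSn _)).
rewrite !addSnnS => /(_ bn); rewrite !addn0 /bump /= addn1.
have -> : \sum_(i < n) b (s + (1 + (1 + i))) = \sum_(i < n) b (s + i.+2) by [].
have -> : \sum_(i < n) b (s.+2 + i) = \sum_(i < n) b (s + i.+2).
  by apply: eq_bigr => i _; rewrite !addSnnS.
move=> le; rewrite addnA; apply: (@leq_add _ _ 1 n./2) le; have := sparse s.
by case: (b s); case: (b s.+1).
Qed.

Lemma sum_ord_add (f : nat -> nat) n k :
  \sum_(i < n + k) f i = \sum_(i < n) f i + \sum_(i < k) f (n + i).
Proof. by rewrite big_split_ord. Qed.

(** * Independent sets described by positions along a copy of the cycle *)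

Section JoinIndependent.
Variables l m : nat.
Hypothesis m3 : 3 <= m.
Implicit Types (x y z : 'I_(l * m)) (A H : {set 'I_(l * m)}).
Local Notation G := (joinG l m).
Local Notation D := (indcomplex (joinG l m)).

Lemma joinG_sym : symmetric G.
Proof. by move=> x y; rewrite !joinGE // eq_sym orbAC. Qed.

Lemma joinG_irr : irreflexive G.
Proof.
move=> x; rewrite joinGE // eqxx /= orbb -{1}[x]shift0 shift_eq mod0n modn_small //.
exact: ltn_trans m3.
Qed.

Lemma joinG_copy x y : ~~ G x y -> x %% l = y %% l.
Proof. by rewrite joinGE // -orbA negb_or negbK => /andP[/eqP]. Qed.

Lemma joinG_shift x d e :
  G (shift x d) (shift x e) = (e == d.+1 %[mod m]) || (d == e.+1 %[mod m]).
Proof. by rewrite joinGE // !shift_mod eqxx /= !shift_shift !shift_eq !addn1. Qed.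

Lemma joinG_shift_lt x d e : d < m -> e < m ->
  G (shift x d) (shift x e) = [|| d.+1 == e, e.+1 == d,
     (d == 0) && (e == m.-1) | (e == 0) && (d == m.-1)].
Proof.
move=> lt_d lt_e; rewrite joinG_shift.
have succ k : k < m -> k.+1 %% m = if k.+1 == m then 0 else k.+1.
  by move=> lt_k; case: eqP => [->|ne]; rewrite ?modnn // modn_small; lia.
rewrite !succ // [d %% m]modn_small // [e %% m]modn_small //; clear - m3 lt_d lt_e.
by case: (eqVneq d.+1 m); case: (eqVneq e.+1 m); lia.
Qed.

Lemma ind_copy A x y : A \in D -> x \in A -> y \in A -> exists2 d, d < m & y = shift x d.
Proof.
by move=> /indcomplexP ind xA yA; apply/same_copy/joinG_copy/ind.
Qed.

Lemma ind_sparse A x d : A \in D -> ~~ ((shift x d \in A) && (shift x d.+1 \in A)).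
Proof.
move=> /indcomplexP ind; apply/andP => -[dA eA].
by have := ind _ _ dA eA; rewrite joinG_shift eqxx.
Qed.

Definition arc_set x (P : pred nat) : {set 'I_(l * m)} :=
  [set shift x (val d) | d : 'I_m & P d].

Lemma shift_inj x : {in gtn m &, injective (shift x)}.
Proof.
by move=> d e lt_d lt_e /eqP; rewrite shift_eq !modn_small // => /eqP.
Qed.

Lemma arc_setP x (P : pred nat) y :
  reflect (exists d, [/\ d < m, P d & y = shift x d]) (y \in arc_set x P).
Proof.
apply: (iffP imsetP) => [[d]|[d [lt_d Pd ->]]].
  by rewrite inE => Pd ->; exists d.
by exists (Ordinal lt_d); rewrite // inE.
Qed.

Lemma mem_arc_set x (P : pred nat) d : d < m -> (shift x d \in arc_set x P) = P d.
Proof.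
move=> lt_d; apply/arc_setP/idP => [[e [lt_e Pe /shift_inj->]]|Pd] //.
by exists d.
Qed.

Lemma card_arc_set x (P : pred nat) : #|arc_set x P| = \sum_(d < m) P d.
Proof.
rewrite card_in_imset => [|d e _ _ /shift_inj/val_inj-> //]; try exact: ltn_ord.
by rewrite -sum1dep_card big_mkcond; apply: eq_bigr => d _; case: (P d).
Qed.

Lemma arc_set_ind x (P : pred nat) : (forall d, ~~ (P d && P d.+1)) ->
  ~~ (P 0 && P m.-1) -> arc_set x P \in D.
Proof.
move=> sparse ends; apply/indcomplexP => _ _ /arc_setP[d [lt_d Pd ->]] /arc_setP[e [lt_e Pe ->]].
rewrite joinG_shift_lt //; apply/negP.
case/or4P=> [/eqP de|/eqP ed|/andP[/eqP d0 /eqP em]|/andP[/eqP e0 /eqP dm]].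
- by have := sparse d; rewrite Pd de Pe.
- by have := sparse e; rewrite Pe ed Pd.
- by move: ends; rewrite -d0 -em Pd Pe.
- by move: ends; rewrite -e0 -dm Pd Pe.
Qed.

Lemma ind_arc_set A x : A \in D -> x \in A -> A = arc_set x (fun d => shift x d \in A).
Proof.
move=> ind xA; apply/setP => y; apply/idP/arc_setP => [yA|[d [_ dA -> //]]].
by have [d lt_d yE] := ind_copy ind xA yA; exists d; rewrite -yE.
Qed.

Lemma card_ind A x : A \in D -> x \in A -> #|A| = \sum_(d < m) (shift x d \in A).
Proof. by move=> ind xA; rewrite {1}(ind_arc_set ind xA) card_arc_set. Qed.

(** The members at positions [0], [p], [p + q] and again [m], which is [0], cut the cycle into three
    arcs to which [sparse_sum] applies separately. Each arc of odd length costs one half, which is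
    the source of the parity restrictions. *)
Lemma card_ind_gaps A x p q r : A \in D -> m = p + q + r ->
  x \in A -> shift x p \in A -> shift x (p + q) \in A ->
  #|A| <= p./2 + q./2 + r./2.
Proof.
move=> ind mE xA pA qA; rewrite (card_ind ind xA).
have gap s n := @sparse_sum (fun d => shift x d \in A) s n (fun d => ind_sparse x d ind).
have split3 (f : nat -> nat) : \sum_(i < m) f i =
    \sum_(i < p) f i + \sum_(i < q) f (p + i) + \sum_(i < r) f (p + q + i).
  by rewrite mE !sum_ord_add.
rewrite (split3 (fun d => shift x d \in A)) !leq_add //; first exact: (gap 0).
  exact: gap.
by apply: gap; rewrite -mE shiftm.
Qed.

Lemma card_ind_le A : A \in D -> #|A| <= m./2.
Proof.
move=> ind; have [->|[x xA]] := set_0Vmem A; first by rewrite cards0.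
by apply: leq_trans (@card_ind_gaps A x 0 0 m ind _ xA _ _) _; rewrite ?shift0.
Qed.

Lemma dsize_ind_le : dsize D <= m./2.
Proof. by apply/dsize_leP => A; apply: card_ind_le. Qed.

(** An odd [d] would split the cycle into two odd arcs, lowering the bound to [m./2 - 1]. *)
Lemma big_ind_even A x d : A \in D -> m./2 <= #|A| -> ~~ odd m ->
  d < m -> x \in A -> shift x d \in A -> ~~ odd d.
Proof.
move=> ind bigA evm lt_d xA dA; apply/negP => oddd.
have := @card_ind_gaps A x d 0 (m - d) ind _ xA dA; rewrite addn0 dA => /(_ _ isT).
by lia.
Qed.

(** With [p] and [q] odd the third arc is odd as well, and three odd arcs leave room for only
    [m./2 - 1] vertices. *)
Lemma big_ind_odd A x p q : A \in D -> m./2 <= #|A| -> odd m ->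
  p + q < m -> x \in A -> shift x p \in A -> shift x (p + q) \in A ->
  ~~ (odd p && odd q).
Proof.
move=> ind bigA oddm lt_pq xA pA qA; apply/negP => /andP[op oq].
have := @card_ind_gaps A x p q (m - (p + q)) ind _ xA pA qA; lia.
Qed.

Lemma step2_ind x : m != 3 -> ~~ G x (shift x 2).
Proof.
move=> m4; rewrite -{1}[x]shift0 joinG_shift_lt //; lia.
Qed.

Lemma step2_facet x : m != 3 ->
  exists2 H, H \in D & #|H| = m./2 /\ [set x; shift x 2] \subset H.
Proof.
move=> m4; pose P d := ~~ odd d && (d < m.-1).
exists (arc_set x P); last split.
- apply: arc_set_ind => [d|]; rewrite /P ?ltnn ?andbF //=.
  by case: (odd d); rewrite ?andbF.
- rewrite card_arc_set; have split1 (f : nat -> nat) n : 0 < n ->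
      \sum_(i < n) f i = \sum_(i < n.-1) f i + f n.-1.
    by case: n => // n _; rewrite big_ord_recr.
  rewrite (split1 P) ?(ltn_trans _ m3) // /P ltnn andbF addn0.
  transitivity (\sum_(i < m.-1) ~~ odd i).
    by apply: eq_bigr => i _; rewrite ltn_ord andbT.
  have -> : m./2 = uphalf m.-1 by lia.
  elim: (m.-1) => [|n IHn]; first by rewrite big_ord0.
  by rewrite big_ord_recr /= IHn; lia.
- rewrite subUset !sub1set -{1}[x]shift0 !mem_arc_set ?/P //=; lia.
Qed.

End JoinIndependent.

(** Faces stay within one copy, while vertices 0 and 1 lie in different copies. *)
Lemma join_disconnected l m (D' : {set {set 'I_(l * m)}}) :
  3 <= m -> 2 <= l -> D' \subset indcomplex (joinG l m) ->
  (forall x, [set x] \in D') -> ~ connected_complex D'.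
Proof.
move=> m3 l2 sub D'1 conn.
have lt0 : 0 < l * m by rewrite muln_gt0 !(ltn_trans _ l2, ltn_trans _ m3).
have lt1 : 1 < l * m by apply: leq_trans (leq_mul l2 m3).
have loc (x y : 'I_(l * m)) : [set x; y] \in D' -> x %% l = y %% l.
  move/(subsetP sub); rewrite (indcomplex_set2 (joinG_sym m3) (joinG_irr m3)).
  exact: joinG_copy.
have := connected_const conn loc (D'1 (Ordinal lt0)) (D'1 (Ordinal lt1)).
by rewrite /= mod0n modn_small.
Qed.

(** * A single cycle: parity and winding *)

Section Cycle.
Variable m : nat.
Hypothesis m3 : 3 <= m.
Implicit Types (x y z : 'I_(1 * m)) (A H : {set 'I_(1 * m)}).
Local Notation D := (indcomplex (joinG 1 m)).

Lemma cycle_shift x d : shift x d = (x + d) %% m :> nat.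
Proof. by rewrite /= modn1 mul1n divn1. Qed.

Lemma cycle_lt x : x < m.
Proof. by have := div_lt x; rewrite divn1. Qed.

Lemma cycle_copy x y : exists2 d, d < m & y = shift x d.
Proof. by apply: same_copy; rewrite !modn1. Qed.

Lemma cycle_shift_sub x y : x <= y -> y = shift x (y - x).
Proof.
by move=> xy; apply/val_inj/esym/(etrans (cycle_shift _ _)); rewrite subnKC // modn_small ?cycle_lt.
Qed.

(** For even [m] the parity of a label is constant on faces that extend to size [m./2]. Allowing a
    general [D'] covers both the square and the skeleton spanned by the largest faces. *)
Lemma even_cycle_disconnected (D' : {set {set 'I_(1 * m)}}) :
  ~~ odd m -> (forall x, [set x] \in D') ->
  (forall A, A \in D' -> 2 <= #|A| -> A \in pure_skeleton D m./2) ->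
  ~ connected_complex D'.
Proof.
move=> evm D'1 big conn.
have lt0 : 0 < 1 * m by rewrite mul1n (ltn_trans _ m3).
have lt1 : 1 < 1 * m by rewrite mul1n (ltn_trans _ m3).
suff loc (x y : 'I_(1 * m)) : [set x; y] \in D' -> odd x = odd y.
  by have := connected_const conn loc (D'1 (Ordinal lt0)) (D'1 (Ordinal lt1)).
move=> xyD; have [->//|xy] := eqVneq x y.
have := big _ xyD; rewrite cards2 xy => /(_ isT)/(pure_skeletonP _ _ (@indcomplex_closed _ _)).
case=> H HD [cH]; rewrite subUset !sub1set => /andP[xH yH].
have [d lt_d yE] := cycle_copy x y; subst y.
have := big_ind_even m3 HD _ evm lt_d xH yH; rewrite cH leqnn => /(_ isT).
by rewrite cycle_shift odd_mod ?(negbTE evm) // oddD => /negbTE->; rewrite addbF.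
Qed.

(** Two parity changes in a row would give two consecutive odd gaps, against [big_ind_odd]. *)
Lemma big_ind_parity H x y z : odd m -> H \in pure_skeleton D m./2 ->
  x \in H -> y \in H -> z \in H -> x < y -> y < z ->
  (odd x == odd y) || (odd y == odd z).
Proof.
move=> oddm /(pure_skeletonP _ _ (@indcomplex_closed _ _))[H' HD [cH /subsetP sub]].
move=> /sub xH /sub yH /sub zH lt_xy lt_yz.
rewrite (cycle_shift_sub (ltnW lt_xy)) in yH.
rewrite (cycle_shift_sub (ltnW (ltn_trans lt_xy lt_yz))) in zH.
have zE : z - x = y - x + (z - y) by lia.
rewrite zE in zH; have ltz := cycle_lt z.
have := big_ind_odd m3 HD _ oddm _ xH yH zH; rewrite cH leqnn => /(_ isT).
by lia.
Qed.

(** [c] is a cocycle since parity changes at most once along a large face in increasing order. A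
    potential would make the sum of [c] over the closed walk of steps of 2 vanish, but that sum is
    [-1]. The cocycle condition only constrains faces with three vertices, so [D'] may have further
    edges. *)
Lemma odd_cycle_not_acyclic1 (R : nzRingType) (D' : {set {set 'I_(1 * m)}}) :
  odd m -> 5 <= m ->
  (forall A, A \in D' -> 3 <= #|A| -> A \in pure_skeleton D m./2) ->
  pure_skeleton D m./2 \subset D' -> ~ acyclic1 R D'.
Proof.
move=> oddm m5 big /subsetP sub.
have no_alt H x y z : H \in D' -> x \in H -> y \in H -> z \in H -> x < y -> y < z ->
    (odd x == odd y) || (odd y == odd z).
  move=> HD' xH yH zH lt_xy lt_yz; apply: (@big_ind_parity H) => //.
  apply: big HD' _; have neq (a b : 'I_(1 * m)) : a < b -> a != b.
    by move=> ab; apply: contraTneq ab => ->; rewrite ltnn.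
  have <- : #|x |: [set y; z]| = 3.
    by rewrite cardsU1 cards2 !inE !negb_or !neq // (ltn_trans lt_xy).
  by apply/subset_leq_card/subsetP => u; rewrite !inE => /or3P[]/eqP->.
(* Steps of 2 run through 1, 3, ..., m - 2, 0, 2, ..., m - 1 and back to 1.  The
   short arc joining [x] odd to [y > x] even within a face contains the closing
   step from m - 1 to 1, and [c] records the passages through it with sign. *)
pose c x y : R := (if [&& odd x, ~~ odd y & (x < y)%N] then 1
                   else if [&& odd y, ~~ odd x & (y < x)%N] then -1 else 0)%R.
case/(_ c) => [H HD' x y z xH yH zH|w wP].
  (* For distinct vertices the cocycle identity fails only when the parities alternate in increasing
     order; all six orders of the triple are excluded. *)
  have := no_alt H x y z HD' xH yH zH; have := no_alt H x z y HD' xH zH yH.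
  have := no_alt H y x z HD' yH xH zH; have := no_alt H y z x HD' yH zH xH.
  have := no_alt H z x y HD' zH xH yH; have := no_alt H z y x HD' zH yH xH.
  rewrite /c {c}; clear no_alt sub big xH yH zH HD' oddm m5.
  case: (ltngtP x y) => xy; case: (ltngtP y z) => yz;
    case: (ltngtP x z) => xz; try (exfalso; lia);
    case ox: (odd x); case oy: (odd y); case oz: (odd z);
    rewrite /= ?addr0 ?add0r ?subrr ?addNr //; by move=> *; exfalso; lia.
have step x : c x (shift x 2) = (w (shift x 2) - w x)%R.
  have [|H HD [cH xH]] := @step2_facet _ _ m3 x; first by lia.
  have HD' : H \in D'.
    by apply/sub/(pure_skeletonP _ _ (@indcomplex_closed _ _)); exists H.
  by move: xH; rewrite subUset !sub1set => /andP[xH yH]; apply: (wP H).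
have lt1 : 1 < 1 * m by rewrite mul1n (ltn_trans _ m3).
pose v := Ordinal lt1.
have valv k : k < m -> shift v k.*2 = (if k.*2.+1 < m then k.*2.+1 else k.*2.+1 - m) :> nat.
  move=> lt_k; rewrite cycle_shift add1n; case: ltnP => le; first by rewrite modn_small.
  by rewrite -{1}(subnK le) modnDr modn_small; lia.
(* All steps but the last have [c = 0]: they preserve parity, except the one from the odd [m - 2]
   down to [0], where the odd label is the larger. *)
have wk k : k < m -> w (shift v k.*2) = w v.
  elim: k => [|k IHk] lt_k; first by rewrite shift0.
  have c0 : c (shift v k.*2) (shift v k.+1.*2) = 0%R.
    rewrite /c !valv ?(ltnW lt_k) //.
    case: (ltnP k.*2.+1 m) => le1; case: (ltnP k.+1.*2.+1 m) => le2;
      by rewrite ifF ?ifF //; lia.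
  have := step (shift v k.*2); rewrite shift_shift addn2 -doubleS c0.
  by move/esym/subr0_eq->; rewrite IHk // ltnW.
(* The closing step from [m - 1] to [1] has [c = -1], although [w] is equal at its ends. *)
have lt_m : m.-1 < m by lia.
have := step (shift v m.-1.*2); rewrite wk // shift_shift.
have -> : shift v (m.-1.*2 + 2) = v.
  by rewrite addn2 -doubleS prednK ?(ltn_trans _ m3) // -addnn -shift_shift !shiftm.
rewrite subrr /c valv //; have -> : (m.-1.*2.+1 < m) = false by lia.
have -> : m.-1.*2.+1 - m = m.-1 by lia.
have -> : nat_of_ord v = 1 by [].
have -> : odd m.-1 = false by lia.
have -> : 1 < m.-1 by lia.
by move/eqP; rewrite /= oppr_eq0 oner_eq0.
Qed.

(** Steps of 2 reach every vertex when [m] is odd: an odd distance [d] is replaced by the even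
    [d + m]. *)
Lemma odd_cycle_connected (D' : {set {set 'I_(1 * m)}}) : odd m ->
  (forall x, [set x; shift x 2] \in D') -> connected_complex D'.
Proof.
move=> oddm edge; apply: const_connected => w loc.
have wk x k : w (shift x k.*2) = w x.
  elim: k => [|k IHk]; first by rewrite shift0.
  by rewrite -IHk [in RHS](loc _ _ (edge _)) shift_shift addn2.
move=> x y _ _; have [d lt_d ->] := cycle_copy x y.
case: (boolP (odd d)) => od; last by rewrite -[d]odd_double_half (negbTE od) wk.
rewrite -shift_modm -modnDr shift_modm -[d + m]odd_double_half oddD od oddm.
by rewrite wk.
Qed.

End Cycle.

(** * Obstructions from a link that is an edge and an isolated point *)

Section PathLink.
Variables (T : finType).
Implicit Types (D : {set {set T}}) (A F H : {set T}).

(* The link of [F] is the independence complex of the path [a - b - c]. *)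
Definition path3_link D F a b c :=
  [/\ a != c, a != b & c != b] /\
  [/\ [set a; c] \in link D F, [set b] \in link D F &
      forall A, A \in link D F -> A \subset [set a; c] \/ A \subset [set b]].

Variables (D : {set {set T}}) (F : {set T}) (a b c : T).
Hypotheses (cl : down_closed D) (P3 : path3_link D F a b c).

Lemma path3_link_dsize : 2 <= dsize (link D F).
Proof. by case: P3 => -[ac _ _] [acL _ _]; apply: leq_dsize acL _; rewrite cards2 ac. Qed.

Lemma path3_link_disconnected : ~ connected_complex (link D F).
Proof.
case: P3 => -[ac ab cb] [acL bL cover] conn.
have aL : [set a] \in link D F by apply: (link_closed cl) acL; rewrite sub1set set21.
suff loc x y : [set x; y] \in link D F -> (x == b) = (y == b).
  by have := connected_const (w := eq_op^~ b) conn loc aL bL; rewrite eqxx (negbTE ab).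
case/cover; rewrite subUset !sub1set; last by move=> /andP[/set1P-> /set1P->].
by move=> /andP[/set2P[]-> /set2P[]->]; rewrite ?(negbTE ab) ?(negbTE cb).
Qed.

(** A facet above [F] with [a] and [c] has at least [#|F| + 2] vertices. One above [F] with [b] has
    at most [#|F| + 1], since its part outside [F] is a face of the link containing [b]. *)
Lemma path3_link_not_pure : ~ pure D.
Proof.
case: P3 => -[ac ab cb] [acL bL cover] purD.
have LD A : A \in link D F -> A :|: F \in D by rewrite inE => /and3P[].
have LF A : A \in link D F -> A :&: F = set0.
  by rewrite inE => /and3P[_ /disjoint_setI0].
have cardL A : A \in link D F -> #|A :|: F| = #|A| + #|F|.
  by move=> AL; rewrite cardsU LF // cards0 subn0.
have [H1 H1f sub1] := facet_above (LD _ acL).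
have [H2 H2f sub2] := facet_above (LD _ bL).
have := purD _ _ H1f H2f; have := subset_leq_card sub1.
rewrite cardL // cards2 ac; case/in_facets: H2f => H2D _.
have FH2 : F \subset H2 by apply: subset_trans sub2; apply: subsetUr.
have H2L : H2 :\: F \in link D F.
  rewrite inE; apply/and3P; split; first by apply: cl H2D; apply: subsetDl.
    by rewrite -setI_eq0 setIDAC setDIl setDv setI0.
  by rewrite setUC setDE setUIr setUCr setIT (setUidPr FH2).
have H2b : H2 :\: F \subset [set b].
  have bH2 : b \in H2 :\: F.
    have := subsetP sub2 b; rewrite !inE eqxx => /(_ isT)->; rewrite andbT.
    by apply/negP => bF; have := LF _ bL => /setP/(_ b); rewrite !inE eqxx bF.
  case: (cover _ H2L) => // /subsetP/(_ b bH2)/set2P[]/eqP.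
    by rewrite eq_sym (negbTE ab).
  by rewrite eq_sym (negbTE cb).
have cardH2 : #|H2| <= 1 + #|F|.
  rewrite -(cardsID F H2) addnC leq_add ?subset_leq_card ?subsetIr //.
  by rewrite -(cards1 b) subset_leq_card.
by move=> le1 eqH; move: le1; rewrite eqH => /leq_trans/(_ cardH2); rewrite leq_add2r.
Qed.

Lemma path3_link_not_CM (K : fieldType) : set0 \in D -> ~ CM K D.
Proof.
case: (P3) => _ [acL _ _] D0 cm; apply: path3_link_disconnected.
have FD : F \in D.
  move: acL; rewrite inE => /and3P[_ _]; apply: cl; exact: subsetUr.
by apply: rbetti1_connected (cm F FD 1 path3_link_dsize); apply: link_closed.
Qed.

End PathLink.

(** * Facets, vertex links and deletions in the join *)

Section JoinFacets.
Variables l m : nat.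
Hypothesis m3 : 3 <= m.
Implicit Types (x y z : 'I_(l * m)) (A H : {set 'I_(l * m)}).
Local Notation G := (joinG l m).
Local Notation D := (indcomplex (joinG l m)).
Let cl : down_closed D := @indcomplex_closed _ _.

Lemma set1_ind x : [set x] \in D.
Proof. exact/indcomplex_set1/joinG_irr. Qed.

Lemma set2_ind x y : ([set x; y] \in D) = ~~ G x y.
Proof. by rewrite (indcomplex_set2 (joinG_sym m3) (joinG_irr m3)). Qed.

Lemma subset_arc_set x (P : pred nat) A :
  (forall y, y \in A -> exists2 d, d < m & P d /\ y = shift x d) -> A \subset arc_set x P.
Proof.
by move=> AP; apply/subsetP => y /AP[d lt_d [Pd ->]]; rewrite mem_arc_set.
Qed.

Lemma facet_neq0 A x : A \in facets D -> A != set0.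
Proof.
case/in_facets=> _ max; apply/eqP => A0.
have := max [set x] (set1_ind x); rewrite A0 sub0set => /(_ isT)/setP/(_ x).
by rewrite !inE eqxx.
Qed.

(** Otherwise the vertex at position [d] could be added to [A]. The expression [d + m.-1] is [d - 1]
    modulo [m], free of truncated subtraction. *)
Lemma facet_dominates A x d : A \in facets D -> x \in A -> d < m ->
  [|| shift x d \in A, shift x d.+1 \in A | shift x (d + m.-1) \in A].
Proof.
case/in_facets=> AD max xA lt_d; apply: contraT; rewrite !negb_or => /and3P[dA d1A dmA].
case/negP: (dA); rewrite -(max (shift x d |: A)) ?setU11 ?subsetUr //.
apply/indcomplexP => u v; have ind := indcomplexP _ _ AD.
have nG y : y \in A -> ~~ G (shift x d) y.
  move=> yA; have [e lt_e yE] := ind_copy m3 AD xA yA; rewrite {}yE in yA *.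
  rewrite joinG_shift //; apply/norP; split.
    by apply: contra d1A => /eqP ed; rewrite -shift_modm -ed shift_modm.
  apply: contra dmA => de; have : d + m.-1 == e %[mod m].
    rewrite -(eqn_modDr 1) -addnA addn1 prednK ?(ltn_trans _ m3) // modnDr addn1.
    by [].
  by move=> /eqP dme; rewrite -shift_modm dme shift_modm.
case/setU1P=> [->|uA] /setU1P[->|vA].
- by rewrite joinG_irr.
- exact: nG.
- by rewrite joinG_sym // nG.
- exact: ind.
Qed.

(** Consecutive members of a maximal set are 2 or 3 steps apart, and each of these [m] is a sum of
    2s and 3s with only one possible number of terms. The proof checks all membership patterns
    [b]. *)
Lemma card_facet A x : m \in [:: 3; 4; 5; 7] -> A \in facets D -> #|A| = m./2.
Proof.
move=> mm Af; have AD : A \in D by case/in_facets: Af.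
have /set0Pn[y yA] := facet_neq0 x Af; rewrite (card_ind m3 AD yA).
pose b d := shift y d \in A; rewrite (eq_bigr (fun d : 'I_m => b d : nat)) //.
have sparse d : ~~ (b d && b d.+1) by apply: ind_sparse.
have dom d : (d.+1 < m) ==> [|| b d, b d.+1 | b d.+2].
  apply/implyP => lt_d; have := facet_dominates Af yA lt_d.
  have -> : d.+1 + m.-1 = d + m by lia.
  rewrite -[shift y (d + m)]shift_modm modnDr shift_modm /b.
  by case/or3P=> ->; rewrite ?orbT.
have b0 : b 0 by rewrite /b shift0.
have bm : b m by rewrite /b shiftm.
clearbody b; clear - mm sparse dom b0 bm.
move: mm sparse dom bm; rewrite !inE => /or4P[]/eqP-> sparse dom bm;
  rewrite !big_ord_recr big_ord0 /=;
  have := sparse 0; have := sparse 1; have := sparse 2; have := sparse 3;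
  have := sparse 4; have := sparse 5; have := sparse 6;
  have := dom 0; have := dom 1; have := dom 2; have := dom 3; have := dom 4;
  rewrite ?b0 ?bm; move: bm;
  by case: (b 1); case: (b 2); case: (b 3); case: (b 4); case: (b 5); case: (b 6).
Qed.

Lemma pure_ind : m \in [:: 3; 4; 5; 7] -> pure D.
Proof.
move=> mm A B Af Bf; have [AB|[x _]] := set_0Vmem [set: 'I_(l * m)].
  have e (C : {set 'I_(l * m)}) : C = set0.
    by apply/eqP; rewrite -subset0 -AB subsetT.
  by rewrite [A]e [B]e.
by rewrite !(card_facet x).
Qed.

Lemma link_set1P x y : [set y] \in link D [set x] ->
  exists d, [/\ 1 < d, d < m.-1 & y = shift x d].
Proof.
rewrite inE => /and3P[_]; rewrite disjoints1 inE setUC set2_ind => yx nG.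
have [d lt_d yE] : exists2 d, d < m & y = shift x d.
  exact/same_copy/(joinG_copy m3).
have m0 : 0 < m by apply: ltn_trans m3.
move: yx nG; rewrite yE -{2}[x]shift0 shift_eq -{1}[x]shift0 joinG_shift_lt //.
by rewrite !modn_small // => d0 nadj; exists d; split=> //; lia.
Qed.

Lemma link_set1_connected7 x : m = 7 -> connected_complex (link D [set x]).
Proof.
move=> m7; apply: const_connected => w loc.
(* Beside [x], the positions 2 to 5 form the link; its edges 2-4, 2-5 and 3-5 make a path. *)
have edge d e : 1 < d -> d.+1 < e -> e < 6 -> w (shift x d) = w (shift x e).
  move=> d1 de e6; apply: loc; pose P := pred3 0 d e.
  have HD : arc_set x P \in D.
    apply: arc_set_ind => // [k|]; first by rewrite /P /=; lia.
    by rewrite /P m7 /=; lia.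
  have memP k : k < m -> P k -> shift x k \in arc_set x P by move=> km; rewrite mem_arc_set.
  rewrite inE; apply/and3P; split.
  - apply: cl HD; rewrite subUset !sub1set !memP ?m7 //= ?eqxx ?orbT //; lia.
  - rewrite disjoint_sym disjoints1 !inE -{1 3}[x]shift0 !shift_eq m7 !modn_small //; lia.
  - apply: cl HD; rewrite !subUset !sub1set -{5}[x]shift0 !memP ?m7 //= ?eqxx ?orbT //; lia.
have w2 d : 1 < d -> d < 6 -> w (shift x d) = w (shift x 2).
  move=> d1 d6; have [->//|d2] := eqVneq d 2; have [->|d3] := eqVneq d 3.
    by rewrite (edge 3 5) // (edge 2 5).
  by rewrite (edge 2 d) //; lia.
move=> y z /link_set1P[d [d1 d6 ->]] /link_set1P[e [e1 e6 ->]].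
by rewrite !w2 // -[6]/(7.-1) -m7.
Qed.

Lemma exists_path3_link x : m = 6 \/ 8 <= m ->
  exists (F : {set 'I_(l * m)}) (a b c : 'I_(l * m)),
    x \in F /\ path3_link D F a b c.
Proof.
(* [P] leaves no gap longer than 3 up to position [m - 6], so the only vertices
   not dominated are those at [m - 4], [m - 3] and [m - 2]. *)
move=> mbad; pose P d := (d == m - 6) || ~~ odd d && (d + 8 <= m).
pose F := arc_set x P.
have lt4 : m - 4 < m by lia.
have lt3 : m - 3 < m by lia.
have lt2 : m - 2 < m by lia.
exists F, (shift x (m - 4)), (shift x (m - 3)), (shift x (m - 2)).
have xF : x \in F.
  by rewrite -[x]shift0 mem_arc_set /P //; lia.
have nF d : m - 4 <= d -> d < m -> shift x d \notin F.
  by move=> ge lt; rewrite mem_arc_set // /P; lia.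
split=> //; split.
  by split; rewrite shift_eq !modn_small //; lia.
have sub k e : arc_set x (fun d => P d || (d == k) || (d == e)) \in D ->
    m - 4 <= k < m -> m - 4 <= e < m -> [set shift x k; shift x e] \in link D F.
  move=> HD /andP[k4 km] /andP[e4 em].
  have sub1 : [set shift x k; shift x e] :|: F \subset
      arc_set x (fun d => P d || (d == k) || (d == e)).
    apply: subset_arc_set => y; rewrite !inE -orbA => /or3P[/eqP->|/eqP->|].
    - by exists k; rewrite // eqxx orbT.
    - by exists e; rewrite // eqxx orbT.
    - by case/arc_setP=> d [lt_d Pd ->]; exists d; rewrite // Pd.
  rewrite inE (cl (subset_trans (subsetUl _ _) sub1) HD).
  by rewrite (cl sub1 HD) andbT -setI_eq0 setIUl setU_eq0 !setI_eq0 !disjoints1 !nF.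
split.
- apply: sub; try lia.
  by apply: arc_set_ind => // [d|]; rewrite /P; lia.
(* The single point is the case [k = e] of [sub]. *)
- rewrite -[[set shift x (m - 3)]]setUid; apply: sub; try lia.
  by apply: arc_set_ind => // [d|]; rewrite /P; lia.
move=> A; rewrite inE => /and3P[AD dAF /indcomplexP ind].
have A3 y : y \in A -> exists2 d, m - 4 <= d < m.-1 & y = shift x d.
  move=> yA; have ind' e (em : e < m) (Pe : P e) : ~~ G y (shift x e).
    by apply: ind; rewrite inE ?yA // mem_arc_set // Pe orbT.
  have yF : y \notin F by apply: contraTN dAF => yF; apply/pred0Pn; exists y; rewrite /= yA.
  have [d lt_d yE] : exists2 d, d < m & y = shift x d.
    apply/same_copy/esym/(joinG_copy m3); rewrite -[x]shift0.
    by apply: ind'; rewrite /P //; lia.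
  exists d => //; rewrite {}yE {yA} mem_arc_set // in ind' yF *.
  (* Any other position has a neighbour in [F]: [0] for [m - 1], [m - 6] for [m - 7] and [m - 5],
     and the even predecessor for a smaller odd position. *)
  apply/negP => out; have [e em [Pe adj]] : exists2 e, e < m & P e /\ G (shift x d) (shift x e).
    have [dl|dl] := boolP (d == m.-1).
      by exists 0; rewrite ?joinG_shift_lt // /P; lia.
    have [d6|d6] := leqP (m - 7) d.
      by exists (m - 6); rewrite ?joinG_shift_lt // /P; move: yF; rewrite /P; lia.
    by exists d.-1; rewrite ?joinG_shift_lt // /P; move: yF; rewrite /P; lia.
  by have := ind' e em Pe; rewrite adj.
have [bA|bA] := boolP (shift x (m - 3) \in A); [right|left].
  apply/subsetP => y yA; have [d dm yE] := A3 y yA.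
  have := ind _ _ (subsetP (subsetUl A F) _ bA) (subsetP (subsetUl A F) _ yA).
  rewrite inE yE joinG_shift_lt //; last by lia.
  by rewrite shift_eq !modn_small //; lia.
apply/subsetP => y yA; have [d dm yE] := A3 y yA; rewrite {y}yE in yA *.
have d3 : d != m - 3 by apply: contraNneq bA => <-.
by rewrite !inE !shift_eq !modn_small //; lia.
Qed.

(** Deleting [x] leaves the path on positions 1 to 6, where 1, 3, 5 are independent while the pair
    2, 5 is already maximal. *)
Lemma heptagon_deletion_not_pure x : m = 7 -> ~ pure (deletion D [set x]).
Proof.
move=> m7 purD; have clD := deletion_closed (F := [set x]) cl.
have arcD (P : pred nat) : arc_set x P \in D -> ~~ P 0 -> arc_set x P \in deletion D [set x].
  move=> AD nP0; rewrite inE AD disjoint_sym disjoints1 -{1}[x]shift0 mem_arc_set //.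
  exact: ltn_trans m3.
have H135 : arc_set x (pred3 1 3 5) \in deletion D [set x].
  by apply: arcD => //; apply: (arc_set_ind m3) => [d|]; rewrite /= ?m7; lia.
have H25 : arc_set x (pred2 2 5) \in deletion D [set x].
  by apply: arcD => //; apply: (arc_set_ind m3) => [d|]; rewrite /= ?m7; lia.
have [H1 H1f sub1] := facet_above H135; have [H2 H2f sub2] := facet_above H25.
have card (P : pred nat) : \sum_(d < m) P d = \sum_(d < 7) P d by rewrite m7.
have le3 : 3 <= #|H2|.
  rewrite (purD _ _ H2f H1f) (leq_trans _ (subset_leq_card sub1)) //.
  by rewrite card_arc_set card !big_ord_recl big_ord0.
have H2D : H2 \in deletion D [set x] by case/in_facets: H2f.
suff : #|H2| <= 2 by rewrite leqNgt le3.
have -> : 2 = #|arc_set x (pred2 2 5)|.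
  by rewrite card_arc_set card !big_ord_recl big_ord0.
apply/subset_leq_card/subsetP => y yH2; move: H2D; rewrite inE => /andP[H2D].
rewrite disjoint_sym disjoints1 => xH2.
have mem2 d : d < m -> pred2 2 5 d -> shift x d \in H2.
  by move=> lt_d Pd; apply: (subsetP sub2); rewrite mem_arc_set.
have H2_2 : shift x 2 \in H2 by rewrite mem2 ?m7.
have H2_5 : shift x 5 \in H2 by rewrite mem2 ?m7.
have [e lt_e yE] := ind_copy m3 H2D H2_2 yH2.
rewrite shift_shift -shift_modm in yE; set d := (2 + e) %% m in yE.
have lt_d : d < m by rewrite ltn_pmod // (ltn_trans _ m3).
clearbody d; rewrite {}yE in yH2 *; rewrite mem_arc_set //.
have /indcomplexP ind := H2D.
have := ind _ _ H2_2 yH2; have := ind _ _ H2_5 yH2.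
have d0 : d != 0 by apply: contraNneq xH2 => d0; rewrite d0 shift0 in yH2.
by rewrite !joinG_shift_lt ?m7 //=; clear - lt_d d0 m7; lia.
Qed.

End JoinFacets.

(** * Complexes of dimension at most one *)

Section SmallComplexes.
Variable T : finType.
Implicit Types (D : {set {set T}}) (A F H V : {set T}).

(** A skeleton with a face of two vertices must have [k = 2], so only that one has to be
    connected. *)
Lemma seqCM_dsize2 (K : fieldType) D : down_closed D -> dsize D <= 2 ->
  (2 <= dsize D -> connected_complex (pure_skeleton D 2)) -> seqCM K D.
Proof.
move=> cl le2 conn k; have clk := pure_skeleton_closed (k := k) cl.
have sub := subsetP (sub_pure_skeleton D k).
have lek : dsize (pure_skeleton D k) <= 2.
  by apply/dsize_leP => F /sub FD; apply: (dsize_leP _ _ le2).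
apply: CM_dsize2 => // /dsize_gt[F /(pure_skeletonP _ _ cl)[H HD [Hk FH]] F2].
have H2 : #|H| = 2.
  by apply/eqP; rewrite eqn_leq (dsize_leP _ _ le2) // (leq_trans F2 (subset_leq_card FH)).
by rewrite -Hk H2; apply/conn/(leq_dsize HD); rewrite H2.
Qed.

Lemma powerset_pure F : pure (powerset F).
Proof.
apply: (@pure_eq_card _ _ #|F|) => A; rewrite powersetE => AF.
by exists F; rewrite ?powersetE.
Qed.

Lemma vertex_decomposable_powerset F : vertex_decomposable (powerset F).
Proof. by apply: vd_simplex; [apply: powerset_pure | exists F]. Qed.

Definition points V : {set {set T}} := [set A in powerset V | #|A| <= 1].

Lemma points_pure V : pure (points V).
Proof.
have [->|[v vV]] := set_0Vmem V.
  apply: (@pure_eq_card _ _ 0) => A; rewrite !inE subset0 => /andP[/eqP-> _].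
  by exists set0; rewrite ?cards0 // !inE sub0set cards0.
apply: (@pure_eq_card _ _ 1) => A; rewrite !inE => /andP[AV].
rewrite leq_eqVlt ltnS leqn0 => /orP[A1|/eqP/cards0_eq->].
  by exists A; [rewrite !inE AV (eqP A1) | split=> //; apply/eqP].
by exists [set v]; rewrite ?sub0set ?cards1 // !inE sub1set vV cards1.
Qed.

Lemma points_vertex_decomposable V : vertex_decomposable (points V).
Proof.
move: {2}#|V| (leqnn #|V|) => n; elim: n V => [|n IHn] V leV.
  have -> : points V = powerset set0.
    apply/setP => A; move: leV; rewrite leqn0 cards_eq0 => /eqP->.
    by rewrite !inE subset0; case: eqP => // ->; rewrite cards0.
  exact: vertex_decomposable_powerset.
have [->|[x xV]] := set_0Vmem V; first by apply: IHn; rewrite cards0.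
apply: (@vd_step _ _ x); first exact: points_pure.
- by rewrite !inE sub1set xV cards1.
- suff -> : link (points V) [set x] = powerset set0.
    exact: vertex_decomposable_powerset.
  apply/setP => A; rewrite !inE subset0 -setI_eq0; apply/idP/eqP => [|->]; last first.
    by rewrite set0I set0U sub0set cards0 sub1set xV cards1 eqxx.
  case/and3P=> _ /eqP Ax /andP[_]; rewrite cardsU Ax cards0 subn0 cards1 addn1 ltnS.
  by rewrite leqn0 cards_eq0 => /eqP.
suff -> : deletion (points V) [set x] = points (V :\ x).
  by apply: IHn; move: leV; rewrite (cardsD1 x V) xV.
apply/setP => A; rewrite !inE disjoint_sym disjoints1 subsetD1.
by rewrite -andbA [(#|A| <= 1) && _]andbC andbA.
Qed.

(** Any order of the points is a shelling. For empty [V] the only facet would be [set0], which the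
    list of singletons misses. *)
Lemma points_shellable V : V != set0 -> shellable (points V).
Proof.
move=> /set0Pn[v vV]; split; first exact: points_pure.
exists [seq [set x] | x <- enum V]; split.
- by rewrite map_inj_uniq ?enum_uniq //; apply: set1_inj.
- apply/setP => F; rewrite inE; apply/mapP/idP => [[x]|].
    rewrite mem_enum => xV ->; apply: (@facet_big _ _ 1); rewrite ?cards1 //.
      by rewrite !inE sub1set xV cards1.
    by move=> H; rewrite inE => /andP[].
  move=> Ff; have Vf : [set v] \in facets (points V).
    apply: (@facet_big _ _ 1); rewrite ?cards1 //.
      by rewrite !inE sub1set vV cards1.
    by move=> H; rewrite inE => /andP[].
  have /eqP/cards1P[x Fx] : #|F| = 1 by rewrite (points_pure Ff Vf) cards1.
  exists x => //; rewrite mem_enum -sub1set -Fx.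
  by case/in_facets: Ff; rewrite !inE => /andP[].
move=> i j; rewrite size_map => /andP[lt_ji lt_i].
have lt_j := ltn_trans lt_ji lt_i.
rewrite !(nth_map v) //; set x := nth v _ i; set y := nth v _ j.
have xy : x != y by rewrite nth_uniq ?enum_uniq // gtn_eqF.
have E : [set x] :\: [set y] = [set x].
  by apply/setP => u; rewrite !inE andbC; case: eqP => //= ->.
exists x; split; first by rewrite E set11.
by exists j; rewrite lt_ji (nth_map v).
Qed.

(** A path as a complex, with its end vertex as a separate argument so that vertices can be stripped
    from that end. *)
Fixpoint path_complex x s : {set {set T}} :=
  if s is y :: s' then powerset [set x; y] :|: path_complex y s' else powerset [set x].

Lemma path_complex_cons x y s A :
  (A \in path_complex x (y :: s)) = (A \subset [set x; y]) || (A \in path_complex y s).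
Proof. by rewrite inE powersetE. Qed.

Lemma path_complex_support x s A u : A \in path_complex x s -> u \in A -> u \in x :: s.
Proof.
elim: s x => [|y s IHs] x /=.
  by rewrite powersetE => /subsetP sub /sub; rewrite !inE.
rewrite inE powersetE => /orP[/subsetP sub /sub|AP uA].
  by rewrite !inE => /orP[]->; rewrite ?orbT.
by rewrite inE (IHs y) ?orbT.
Qed.

Lemma path_complex_head x s A : A \subset [set x] -> A \in path_complex x s.
Proof.
case: s => [|y s] Ax /=; first by rewrite powersetE.
by rewrite inE powersetE (subset_trans Ax) // sub1set set21.
Qed.

Lemma path_complex_pure x y s : uniq [:: x, y & s] -> pure (path_complex x (y :: s)).
Proof.
move=> un; apply: (@pure_eq_card _ _ 2); elim: s x y un => [|z s IHs] x y /= /andP[xs un] A.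
  have xy : x != y by rewrite inE in xs.
  rewrite inE !powersetE => AP; exists [set x; y]; first by rewrite inE powersetE subxx.
  rewrite cards2 xy; split=> //; case/orP: AP => // /subset_trans; apply.
  by rewrite sub1set set22.
have xy : x != y by apply: contraNneq xs => ->; rewrite mem_head.
rewrite inE powersetE => /orP[AP|/IHs[//|H HP ?]].
  by exists [set x; y]; rewrite ?cards2 ?xy // inE powersetE subxx.
by exists H => //; rewrite inE HP orbT.
Qed.

(** At the end vertex [x] the link is the single point [y] and the deletion is the shorter path. *)
Lemma path_complex_vertex_decomposable x y s :
  uniq [:: x, y & s] -> vertex_decomposable (path_complex x (y :: s)).
Proof.
elim: s x y => [|z s IHs] x y un.
  rewrite /=; have -> : powerset [set x; y] :|: powerset [set y] = powerset [set x; y].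
    by apply/setUidPl; rewrite powersetS sub1set set22.
  exact: vertex_decomposable_powerset.
have := un; rewrite cons_uniq => /andP[xs un'].
have noX A : A \in path_complex y (z :: s) -> x \notin A.
  by move=> AP; apply: contra xs; apply: path_complex_support.
apply: (@vd_step _ _ x); first exact: path_complex_pure.
- by rewrite path_complex_head.
- suff -> : link (path_complex x [:: y, z & s]) [set x] = powerset [set y].
    exact: vertex_decomposable_powerset.
  have xy : x != y by apply: contraNneq xs => ->; rewrite mem_head.
  have split1 A : x \notin A -> (A \subset [set y]) = (A :|: [set x] \subset [set x; y]).
    move=> xA; rewrite subUset sub1set set21 andbT -subDset.
    by have /setDidPl -> : [disjoint A & [set x]] by rewrite disjoint_sym disjoints1.
  apply/setP => A; rewrite inE !(path_complex_cons x) disjoint_sym disjoints1 powersetE.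
  have [xA|xA] := boolP (x \in A); rewrite ?andbF /=.
    by apply/esym/negP => /subsetP/(_ x xA); rewrite inE (negbTE xy).
  rewrite -split1 //.
  have -> : (A :|: [set x] \in path_complex y (z :: s)) = false.
    by apply/negP => /noX; rewrite !inE eqxx orbT.
  rewrite orbF; case Ay: (A \subset [set y]); rewrite ?andbF // andbT.
  by rewrite (subset_trans Ay) ?sub1set ?set22.
suff -> : deletion (path_complex x [:: y, z & s]) [set x] = path_complex y (z :: s).
  exact: IHs.
apply/setP => A; rewrite inE disjoint_sym disjoints1 path_complex_cons.
apply/andP/idP => [[/orP[sub|//] xA]|AP]; last by rewrite AP orbT noX.
apply/path_complex_head/subsetP => u uA; have := subsetP sub u uA.
by rewrite !inE; case: eqP => // ux; rewrite -ux uA in xA.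
Qed.

End SmallComplexes.

(** * The pentagon *)

Section Pentagon.
Implicit Types (x y z : 'I_(1 * 5)) (A H : {set 'I_(1 * 5)}).
Local Notation D := (indcomplex (joinG 1 5)).
Let m3 : 3 <= 5 := isT.
Let cl : down_closed D := @indcomplex_closed _ _.

Lemma pentagon_set2 x d e :
  ([set shift x d; shift x e] \in D) = ~~ ((e == d.+1 %[mod 5]) || (d == e.+1 %[mod 5])).
Proof. by rewrite set2_ind // joinG_shift. Qed.

Lemma pentagon_vertex_decomposable : vertex_decomposable D.
Proof.
pose x : 'I_(1 * 5) := Ordinal (isT : 0 < 1 * 5).
have subP A (p q : nat) :
    (forall d, d < 5 -> shift x d \in A -> (d == p) || (d == q)) ->
    A \subset [set shift x p; shift x q].
  move=> Apq; apply/subsetP => y yA; have [d lt_d yE] := cycle_copy x y.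
  by rewrite yE in yA *; rewrite !inE; case/orP: (Apq d lt_d yA) => /eqP->; rewrite eqxx ?orbT.
apply: (@vd_step _ _ x); first exact: pure_ind.
- exact: set1_ind.
- suff -> : link D [set x] = points [set shift x 2; shift x 3].
    exact: points_vertex_decomposable.
  apply/setP => A; apply/idP/idP => [AL|].
    have sub : A \subset [set shift x 2; shift x 3].
      apply/subsetP => y yA; have yL : [set y] \in link D [set x].
        by apply: (link_closed cl) AL; rewrite sub1set.
      have [d [d1 d4 ->]] := link_set1P m3 yL.
      by rewrite !inE !shift_eq; move: d d1 d4 => [|[|[|[|]]]].
    rewrite !inE sub; move: AL; rewrite inE disjoint_sym disjoints1 => /and3P[_ xA].
    by move/(card_ind_le m3); rewrite setUC cardsU1 xA.
  rewrite inE powersetE => /andP[sub A1].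
  have xA : x \notin A.
    by apply/negP => /(subsetP sub); rewrite -{1}[x]shift0 !inE !shift_eq.
  have AxD : A :|: [set x] \in D.
    have [->|[y yA]] := set_0Vmem A; first by rewrite set0U set1_ind.
    have -> : A = [set y].
      by apply/esym/eqP; rewrite eqEcard sub1set yA cards1.
    by case/set2P: (subsetP sub y yA) => ->; rewrite -{2}[x]shift0 pentagon_set2.
  by rewrite inE (cl (subsetUl _ _) AxD) AxD disjoint_sym disjoints1 xA.
(* The non-adjacent pairs among positions 1 to 4 are 3-1, 1-4 and 4-2, and they form a path. *)
suff -> : deletion D [set x] =
    path_complex (shift x 3) [:: shift x 1; shift x 4; shift x 2].
  apply: path_complex_vertex_decomposable.
  by rewrite !cons_uniq !inE !shift_eq.
apply/setP => A; rewrite inE disjoint_sym disjoints1 !path_complex_cons.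
have -> : (A \in path_complex (shift x 2) [::]) = (A \subset [set shift x 2]).
  by rewrite powersetE.
apply/andP/idP => [[AD xA]|].
  have sparse d := ind_sparse m3 x d AD.
  have b0 : shift x 0 \in A = false by rewrite shift0 (negbTE xA).
  have [b2|b2] := boolP (shift x 2 \in A).
    suff -> : A \subset [set shift x 4; shift x 2] by rewrite ?orbT.
    apply: subP => -[|[|[|[|[|]]]]] //= _; first by rewrite b0.
      by move=> b1; have := sparse 1; rewrite b1 b2.
    by move=> b3; have := sparse 2; rewrite b2 b3.
  have [b3|b3] := boolP (shift x 3 \in A).
    suff -> : A \subset [set shift x 3; shift x 1] by rewrite ?orbT.
    apply: subP => -[|[|[|[|[|]]]]] //= _; rewrite ?b0 ?(negbTE b2) //.
    by move=> b4; have := sparse 3; rewrite b3 b4.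
  suff -> : A \subset [set shift x 1; shift x 4] by rewrite ?orbT.
  by apply: subP => -[|[|[|[|[|]]]]] //= _; rewrite ?b0 ?(negbTE b2) ?(negbTE b3).
have edge p q : (0 < p < 5) && (0 < q < 5) ->
    ~~ ((q == p.+1 %[mod 5]) || (p == q.+1 %[mod 5])) ->
    A \subset [set shift x p; shift x q] -> A \in D /\ x \notin A.
  move=> pq adj sub; split; first by apply: cl sub _; rewrite pentagon_set2.
  apply/negP => /(subsetP sub); rewrite -{1}[x]shift0 !inE !shift_eq.
  by rewrite !modn_small; lia.
case/or4P=> [||| sub]; [exact: edge | exact: edge | exact: edge |].
by apply: (edge 2 2) => //; rewrite setUid.
Qed.

(** The complex is again a 5-cycle, traversed by steps of 2. Each edge [E i] with [i > 0] meets its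
    predecessor in one vertex. *)
Lemma pentagon_shellable : shellable D.
Proof.
split; first exact: pure_ind.
pose x : 'I_(1 * 5) := Ordinal (isT : 0 < 1 * 5).
pose E i := [set shift x i.*2; shift x i.*2.+2].
have memE d i : (shift x d \in E i) = (d == i.*2 %[mod 5]) || (d == i.*2.+2 %[mod 5]).
  by rewrite !inE !shift_eq.
have ED i : E i \in D by rewrite /E pentagon_set2; lia.
have E2 i : #|E i| = 2 by rewrite /E cards2 shift_eq; lia.
have Einj : {in gtn 5 &, injective E}.
  move=> i j lt_i lt_j Eij; have : shift x i.*2 \in E j by rewrite -Eij set21.
  have : shift x j.*2 \in E i by rewrite Eij set21.
  by rewrite !memE; move: lt_i lt_j; rewrite !inE; lia.
exists [seq E i | i <- iota 0 5]; split.
- rewrite map_inj_in_uniq ?iota_uniq // => i j; rewrite !mem_iota => lt_i lt_j.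
  exact: Einj.
- apply/setP => F; rewrite inE; apply/mapP/idP => [[i _ ->]|Ff].
    apply: (@facet_big _ _ 2) => // [H /(card_ind_le m3)//|].
    by rewrite E2.
  have FD : F \in D by case/in_facets: Ff.
  have /eqP/cards2P[u [v [uv Fuv]]] := card_facet m3 x isT Ff.
  rewrite Fuv in FD *; have step y : exists2 i, i \in iota 0 5 & [set y; shift y 2] = E i.
    have [d lt_d ->] := cycle_copy x y.
    (* 3 is the inverse of 2 modulo 5. *)
    exists ((3 * d) %% 5); first by rewrite mem_iota; lia.
    rewrite shift_shift /E; congr [set _; _]; apply/eqP; rewrite shift_eq; lia.
  have [d lt_d vE] := cycle_copy u v.
  move: uv FD; rewrite vE -{1 3}[u]shift0 shift_eq pentagon_set2.
  move: d lt_d vE => [|[|[|[|[|]]]]] //= _ vE _ _.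
  (* Only distance 3 remains, which is a step of 2 from the other end back to [u]. *)
  have [i i5 iE] := step (shift u 3); exists i => //.
  by rewrite -iE shift_shift (shiftm u) setUC.
rewrite size_map size_iota => i j /andP[lt_ji lt_i].
have nthE k : k < 5 -> nth set0 [seq E i | i <- iota 0 5] k = E k.
  by move=> lt_k; rewrite (nth_map 0) ?size_iota // nth_iota.
have ED1 k d e : (d == i.*2 %[mod 5]) && (e == i.*2.+2 %[mod 5])
    || (e == i.*2 %[mod 5]) && (d == i.*2.+2 %[mod 5]) ->
    shift x d \notin E k -> shift x e \in E k -> E i :\: E k = [set shift x d].
  move=> de dk ek; have Ei : E i = [set shift x d; shift x e].
    case/orP: de => /andP[/eqP d_ /eqP e_]; rewrite /E.
      by congr [set _; _]; apply/eqP; rewrite shift_eq ?d_ ?e_.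
    by rewrite setUC; congr [set _; _]; apply/eqP; rewrite shift_eq ?d_ ?e_.
  apply/setP => u; rewrite in_setD Ei in_set2 in_set1.
  have [->|ud] := eqVneq u (shift x d); first by rewrite dk.
  by have [->|//] := eqVneq u (shift x e); rewrite ?ek ?andbF.
rewrite !nthE // ?(ltn_trans lt_ji) //.
(* The far end of [E i] is a new vertex, except that [E 4] closes the cycle at [E 0]: there the
   vertex outside [E 0] is the near end, at position 8. *)
have [/andP[/eqP i4 /eqP j0]|ij] := boolP ((i == 4) && (j == 0)).
  exists (shift x 8); rewrite inE !memE i4 j0; split=> //.
  by exists 0; split=> //; rewrite nthE //; have := ED1 0 8 10; rewrite !memE i4; apply.
exists (shift x i.*2.+2); rewrite inE !memE; split; first by lia.
exists i.-1; split; first by lia.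
rewrite nthE; last by lia.
by apply: (ED1 _ _ i.*2); rewrite ?memE; lia.
Qed.

End Pentagon.

(** * Induced matchings *)

Section InducedMatching.
Variables l m : nat.
Hypothesis m3 : 3 <= m.
Implicit Types (x y z : 'I_(l * m)) (M : {set {set 'I_(l * m)}}).
Local Notation G := (joinG l m).

Lemma induced_matchingP M :
  reflect [/\ forall e, e \in M -> exists u v, [/\ u != v, G u v & e = [set u; v]],
              forall e f u, e \in M -> f \in M -> u \in e -> u \in f -> e = f &
              forall e f u v, e \in M -> f \in M -> u \in e -> v \in f -> G u v ->
                [set u; v] \in M]
          (induced_matching G M).
Proof.
apply: (iffP and3P) => -[edges disj ind]; split.
- move=> e eM; have /existsP[u /existsP[v /andP[/andP[uv Guv] /eqP ->]]] := forall_inP edges e eM.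
  by exists u, v.
- move=> e f u eM fM ue uf; apply: contraTeq isT => ef.
  have /forall_inP/(_ f fM)/implyP/(_ ef) := forall_inP disj e eM.
  by move/pred0P/(_ u); rewrite /= ue uf.
- move=> e f u v eM fM ue vf; have uM : u \in cover M by apply/bigcupP; exists e.
  have vM : v \in cover M by apply/bigcupP; exists f.
  by have /forall_inP/(_ v vM)/implyP := forall_inP ind u uM.
- apply/forall_inP => e /edges[u [v [uv Guv ->]]].
  by apply/existsP; exists u; apply/existsP; exists v; rewrite uv Guv eqxx.
- apply/forall_inP => e eM; apply/forall_inP => f fM; apply/implyP => ef.
  apply/pred0P => u; apply/negP => /andP[ue uf]; case/eqP: ef; exact: (disj e f u).
- apply/forall_inP => u /bigcupP[e eM ue]; apply/forall_inP => v /bigcupP[f fM vf].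
  by apply/implyP; apply: (ind e f).
Qed.

(** In the copy of [x], take the edges at positions [3 * j] and [3 * j + 1]; the position after each
    one separates it from the next, also across the wrap-around. *)
Lemma induced_matching_ge x : m %/ 3 <= induced_matching_number G.
Proof.
pose E (j : 'I_(m %/ 3)) := [set shift x (3 * j); shift x (3 * j).+1].
have lt_E (j : 'I_(m %/ 3)) : (3 * j).+2 < m by have := ltn_ord j; lia.
have memE u j : u \in E j -> exists d, [/\ d < m.-1, d %/ 3 = j, d %% 3 <= 1 & u = shift x d].
  by have := lt_E j; rewrite !inE => lt /orP[]/eqP->; eexists; split; try reflexivity; lia.
have Einj : injective E.
  move=> i j Eij; have : shift x (3 * i) \in E j by rewrite -Eij set21.
  case/memE=> d [lt_d dj d1] /eqP; have lt_i := lt_E i.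
  have [lt_3i lt_dm] : 3 * i < m /\ d < m by lia.
  by rewrite shift_eq (modn_small lt_3i) (modn_small lt_dm) => id; apply: val_inj => /=; lia.
have <- : #|[set E j | j in 'I_(m %/ 3)]| = m %/ 3 by rewrite card_imset ?card_ord.
apply: (leq_bigmax_cond (F := fun M : {set {set 'I_(l * m)}} => #|M|)).
have same j k u v : u \in E j -> v \in E k -> (u == v) || G u v -> j = k.
  case/memE=> d [lt_d dj d1 ->] /memE[e [lt_e ek e1 ->]].
  have [ltd lte] : d < m /\ e < m by lia.
  rewrite shift_eq joinG_shift_lt // (modn_small ltd) (modn_small lte) => adj.
  by apply: val_inj => /=; lia.
apply/induced_matchingP; split.
- move=> _ /imsetP[j _ ->]; exists (shift x (3 * j)), (shift x (3 * j).+1).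
  have := lt_E j => lt; split=> //; first by rewrite shift_eq !modn_small; lia.
  by rewrite joinG_shift_lt ?eqxx //; lia.
- move=> _ _ u /imsetP[j _ ->] /imsetP[k _ ->] uj uk.
  by rewrite (same j k u u) ?eqxx.
- move=> _ _ u v /imsetP[j _ ->] /imsetP[k _ ->] uj vk Guv.
  have jk : j = k by apply: (same j k u v); rewrite // Guv orbT.
  rewrite -jk in vk; apply/imsetP; exists j => //.
  move: uj vk Guv; rewrite !inE => /orP[]/eqP-> /orP[]/eqP->; rewrite ?joinG_irr // => _.
  by rewrite setUC.
Qed.

Lemma induced_matching_le : induced_matching_number G <= m %/ 3.
Proof.
apply/bigmax_leqP => M /induced_matchingP[edges disj ind].
have cross e f u v : e \in M -> f \in M -> e != f -> u \in e -> v \in f -> ~~ G u v.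
  move=> eM fM ef ue vf; apply: contra ef => Guv; have uvM := ind e f u v eM fM ue vf Guv.
  by rewrite (disj e [set u; v] u) ?set21 // (disj f [set u; v] v) ?set22.
(* A single edge may join two copies and is counted apart. *)
case: (leqP #|M| 1) => [M1|M2]; first by rewrite (leq_trans M1) // divn_gt0.
(* Vertices of different matching edges are non-adjacent, hence in one copy. The two ends of the
   same edge are compared through a second edge [g]. *)
have copy e f u v : e \in M -> f \in M -> u \in e -> v \in f -> u %% l = v %% l.
  have diff a b y z : a \in M -> b \in M -> a != b -> y \in a -> z \in b -> y %% l = z %% l.
    by move=> aM bM ab ya zb; apply/(joinG_copy m3)/(cross a b).
  move=> eM fM ue vf; have [ef|ef] := eqVneq e f; last exact: (diff e f).
  have /card_gt0P[g] : 0 < #|M :\ e| by move: M2; rewrite (cardsD1 e) eM.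
  rewrite !inE => /andP[ge gM]; have [w [w' [_ _ gE]]] := edges g gM.
  have wg : w \in g by rewrite gE set21.
  rewrite (diff e g u w) // 1?eq_sym // (diff g f w v) //.
  by rewrite -ef.
have tailP e : e \in M -> exists u, e == [set u; shift u 1].
  move=> eM; have [u [v [_ Guv eE]]] := edges e eM.
  have uv : u %% l = v %% l by apply: (copy e e); rewrite // eE ?set21 ?set22.
  move: Guv; rewrite joinGE // uv eqxx /= => /orP[]/eqP E; [exists u | exists v].
    by rewrite -E eE.
  by rewrite -E eE setUC.
have [e0 e0M] : exists e, e \in M by apply/card_gt0P/(ltn_trans _ M2).
have [x /eqP e0E] := tailP e0 e0M.
pose tail e := odflt x [pick u | e == [set u; shift u 1]].
have tailE e : e \in M -> e = [set tail e; shift (tail e) 1].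
  by rewrite /tail => /tailP[u]; case: pickP => [v /eqP|/(_ u)->].
(* The edge [u, u + 1] claims the three positions [u], [u + 1], [u + 2]; in an
   induced matching distinct edges claim disjoint triples. *)
pose pos (p : {set 'I_(l * m)} * 'I_3) : 'I_(l * m) := shift (tail p.1) p.2.
have tm e : e \in M -> tail e \in e by move=> eM; rewrite {2}(tailE e eM) set21.
have tm1 e : e \in M -> shift (tail e) 1 \in e by move=> eM; rewrite {2}(tailE e eM) set22.
have adj1 y : G y (shift y 1) by rewrite joinGE // eqxx orbT.
have shiftK y z i : i <= m -> shift y i = shift z i -> y = z.
  move=> le_i /(congr1 (fun y => shift y (m - i))).
  by rewrite !shift_shift subnKC // !shiftm.
have meet e f i j : e \in M -> f \in M -> j <= i < 3 ->
    shift (tail e) i = shift (tail f) j -> e = f.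
  move=> eM fM /andP[ji i3]; rewrite -(subnK ji) -shift_shift => /shiftK fE.
  have {}fE : shift (tail e) (i - j) = tail f by apply: fE; lia.
  (* At difference 2 the tail of [f] follows the head of [e], so [e] and [f] would be joined by an
     edge. At a smaller difference the tail of [f] lies in [e]. *)
  have [ij2|ij2] := eqVneq (i - j) 2.
    have u2 : tail f = shift (shift (tail e) 1) 1 by rewrite shift_shift -fE ij2.
    apply: contraTeq (adj1 (shift (tail e) 1)) => ef; rewrite -u2.
    by apply: (cross e f); rewrite ?tm ?tm1.
  apply: (disj e f (tail f)); rewrite ?tm // -fE.
  have [->|ij0] := eqVneq (i - j) 0; first by rewrite shift0 tm.
  have -> : i - j = 1 by lia.
  exact: tm1.
have posinj : {in setX M [set: 'I_3] &, injective pos}.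
  move=> [e i] [f j]; rewrite !inE !andbT /pos /= => eM fM eif.
  have ef : e = f.
    case: (leqP j i) => ij; first by apply: (meet e f i j); rewrite // ij ltn_ord.
    by apply/esym/(meet f e j i); rewrite ?(ltnW ij) ?ltn_ord.
  rewrite ef in eif *; congr (_, _); apply/val_inj/(shift_inj _ _ eif).
    exact: leq_trans (ltn_ord i) m3.
  exact: leq_trans (ltn_ord j) m3.
rewrite leq_divRL // -{1}[3]card_ord -cardsT -cardsX -(card_in_imset posinj).
have sub : pos @: setX M [set: 'I_3] \subset arc_set x xpredT.
  apply: subset_arc_set => _ /imsetP[[e i] /setXP[eM _] ->].
  have [|d lt_d yE] := @same_copy _ _ x (pos (e, i)); last by exists d.
  by rewrite shift_mod; apply: (copy e0 e); rewrite ?tm // e0E set21.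
by rewrite (leq_trans (subset_leq_card sub)) // card_arc_set sum1_card card_ord.
Qed.

End InducedMatching.

(** * Disconnected complexes and skeletons *)

Lemma disconnected_ind l m : 3 <= m -> m = 4 \/ 4 <= m /\ 2 <= l ->
  1 <= l -> ~ connected_complex (indcomplex (joinG l m)).
Proof.
move=> m3 lm l1; case: (leqP 2 l) => [l2|].
  by apply: join_disconnected => // x; apply: set1_ind.
case: lm => [m4|[_ l2]]; last by rewrite ltnNge l2.
rewrite ltnS leq_eqVlt ltnNge l1 orbF => /eqP->; rewrite {}m4.
(* For [m = 4] every pair already has the top size [m./2]. *)
apply: (@even_cycle_disconnected 4) => // [x|A AD A2]; first exact: set1_ind.
apply/pure_skeletonP; first exact: indcomplex_closed.
by exists A => //; split=> //; apply/eqP; rewrite eqn_leq A2 (card_ind_le _ AD).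
Qed.

Lemma dsize_ind_ge2 l m : 4 <= m -> 1 <= l -> 2 <= dsize (indcomplex (joinG l m)).
Proof.
move=> m4 l1; have lm0 : 0 < l * m by rewrite muln_gt0 l1 (ltn_trans _ m4).
have [||H HD [cH _]] := @step2_facet l m _ (Ordinal lm0); try by lia.
by apply: leq_dsize HD _; lia.
Qed.

(** With several copies the skeleton [k = 2] contains every vertex and keeps the copies apart; for a
    single even cycle [k = m./2] separates the parities. *)
Lemma skeleton_disconnected l m : 3 <= m -> 1 <= l ->
  (4 <= m /\ 2 <= l) \/ (l = 1 /\ 4 <= m /\ ~~ odd m) ->
  exists k, ~ connected_complex (pure_skeleton (indcomplex (joinG l m)) k)
         /\ 2 <= dsize (pure_skeleton (indcomplex (joinG l m)) k).
Proof.
move=> m3 l1 lm; have m4 : 4 <= m by case: lm => [[]|[_ []]].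
have cl := @indcomplex_closed _ (joinG l m).
have lm0 : 0 < l * m by rewrite muln_gt0 l1 (ltn_trans _ m3).
have step x : exists2 H, H \in indcomplex (joinG l m) & #|H| = m./2 /\ [set x; shift x 2] \subset H.
  by apply: step2_facet => //; lia.
case: lm => [[_ l2]|[{}l1 [_ evm]]].
  exists 2; have Sk x : [set x; shift x 2] \in pure_skeleton (indcomplex (joinG l m)) 2.
    apply/(pure_skeletonP _ _ cl); exists [set x; shift x 2].
      by have [H HD [_ sub]] := step x; apply: cl HD.
    split=> //; rewrite cards2 -{1}[x]shift0 shift_eq !modn_small //; lia.
  split; last first.
    apply: (leq_dsize (Sk (Ordinal lm0))).
    rewrite cards2 -{1}[Ordinal _]shift0 shift_eq !modn_small //; lia.
  apply: join_disconnected => // [|x]; first exact: sub_pure_skeleton.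
  by apply: (pure_skeleton_closed cl) (Sk x); rewrite sub1set set21.
exists m./2; split; last first.
  have [H HD [cH _]] := step (Ordinal lm0).
  apply: (@leq_dsize _ _ H); last by lia.
  by apply/(pure_skeletonP _ _ cl); exists H.
move: cl step; rewrite {lm0}l1 => cl step.
apply: even_cycle_disconnected => // x; have [H HD [cH sub]] := step x.
apply/(pure_skeletonP _ _ cl); exists H => //; split=> //.
by apply: subset_trans sub; rewrite sub1set set21.
Qed.

(** * The properties of the join *)

(** For [m = 3] the bound [m./2] on independent sets equals 1. *)
Lemma triangle_indcomplex l : indcomplex (joinG l 3) = points [set: 'I_(l * 3)].
Proof.
apply/setP => A; rewrite [RHS]inE powersetE subsetT /=.
apply/idP/idP => [/card_ind_le-> //|]; rewrite leq_eqVlt ltnS leqn0.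
case/orP=> [/cards1P[x ->]|]; first exact: set1_ind.
by rewrite cards_eq0 => /eqP->; apply: set0_indcomplex.
Qed.

Section SkeletonsOfCycles.
Variables (K : fieldType) (m : nat).
Hypothesis m3 : 3 <= m.
Local Notation D := (indcomplex (joinG 1 m)).
Let cl : down_closed D := @indcomplex_closed _ _.

(** Size at least 3 puts homological degree 1 below the top dimension, where Cohen-Macaulayness
    would force it to vanish. *)
Lemma odd_cycle_top_skeleton : odd m -> 7 <= m ->
  [/\ down_closed (pure_skeleton D m./2), ~ acyclic1 K (pure_skeleton D m./2),
      set0 \in pure_skeleton D m./2 & 3 <= dsize (pure_skeleton D m./2)].
Proof.
move=> oddm m7; have lt0 : 0 < 1 * m by rewrite mul1n (ltn_trans _ m3).
have [|H HD [cH _]] := step2_facet m3 (Ordinal lt0); first by lia.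
split.
- exact: pure_skeleton_closed.
- by apply: (odd_cycle_not_acyclic1 m3) => //; lia.
- by apply/(pure_skeletonP _ _ cl); exists H; rewrite ?sub0set.
- apply: (@leq_dsize _ _ H); last by lia.
  by apply/(pure_skeletonP _ _ cl); exists H.
Qed.

Lemma heptagon_not_acyclic1 : m = 7 -> ~ acyclic1 K D /\ 3 <= dsize D.
Proof.
move=> m7; have oddm : odd m by rewrite m7.
have [_ _ _ S3] := odd_cycle_top_skeleton oddm (eq_leq (esym m7)); split.
  apply: (odd_cycle_not_acyclic1 m3) => // [|A AD A3|]; first by lia.
    apply/(pure_skeletonP _ _ cl); exists A => //; split=> //.
    by apply/eqP; rewrite eqn_leq card_ind_le //; apply: leq_trans A3; rewrite m7.
  exact: sub_pure_skeleton.
have [H HS H3] := dsize_gt S3; apply: leq_dsize H3.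
exact: (subsetP (sub_pure_skeleton D m./2)).
Qed.

Lemma odd_cycle_ind_connected : odd m -> 5 <= m -> connected_complex D.
Proof.
move=> oddm m5; apply: odd_cycle_connected => // x.
by rewrite set2_ind // step2_ind //; lia.
Qed.

End SkeletonsOfCycles.

Section JoinProperties.
Variables (K : fieldType) (l m : nat).
Hypotheses (l1 : 1 <= l) (m3 : 3 <= m).
Local Notation D := (indcomplex (joinG l m)).
Let cl : down_closed D := @indcomplex_closed _ _.

Let v0 : 'I_(l * m).
Proof. by exists 0; rewrite muln_gt0 l1 (ltn_trans _ m3). Defined.

Lemma large_cases : m \notin [:: 3; 4; 5; 7] -> m = 6 \/ 8 <= m.
Proof. by rewrite !inE; lia. Qed.

Lemma pure_join_iff : pure D <-> m \in [:: 3; 4; 5; 7].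
Proof.
split=> [purD|]; last exact: pure_ind.
apply: contraT => /large_cases/(exists_path3_link m3 v0)[F [a [b [c [_ P3]]]]].
by case: (path3_link_not_pure cl P3).
Qed.

Lemma buchsbaum_iff : buchsbaum K (joinG l m) <-> m \in [:: 3; 4; 5; 7].
Proof.
split=> [buch|mm x].
  apply: contraT => /large_cases/(exists_path3_link m3 v0)[F [a [b [c [xF P3]]]]].
  have := buch v0; rewrite (minus_nbhd_link (joinG_sym m3) (joinG_irr m3)).
  have FE : [set v0] :|: F :\ v0 = F by rewrite setD1K.
  have P3' : path3_link (link D [set v0]) (F :\ v0) a b c.
    by rewrite /path3_link link_link ?FE // disjoints1 setD11.
  case/(path3_link_not_CM (link_closed cl) P3').
  by rewrite inE set0_indcomplex set0U set1_ind // -setI_eq0 set0I eqxx.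
rewrite (minus_nbhd_link (joinG_sym m3) (joinG_irr m3)).
(* The links of vertices thus have at most two vertices per face, and exactly two only for
   [m = 7]. *)
have le : dsize (link D [set x]) <= m./2.-1.
  rewrite leqNgt; apply/negP => /dsize_link_add[H /(card_ind_le m3)].
  by rewrite cards1 => le /leq_trans/(_ le); lia.
apply: CM_dsize2 => [||d2]; first exact: link_closed.
  by apply: leq_trans le _; move: mm; rewrite !inE; lia.
by apply: link_set1_connected7 => //; move: mm; rewrite !inE; lia.
Qed.

(** Three sources of failure: non-purity, disconnectedness, and the heptagon, which needs its own
    argument for each property. *)
Lemma bad_cases : ~~ ((m == 3) || (l == 1) && (m == 5)) ->
  [\/ m \notin [:: 3; 4; 5; 7], m = 4 \/ 4 <= m /\ 2 <= l | l = 1 /\ m = 7].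
Proof.
move=> bad; have [mm|_] := boolP (m \in [:: 3; 4; 5; 7]); last by constructor 1.
have [l2|l2] := leqP 2 l; first by constructor 2; move: mm; rewrite !inE; lia.
have [m4|m4] := eqVneq m 4; first by constructor 2; left.
by constructor 3; move: mm; rewrite !inE; lia.
Qed.

Lemma goodP : reflect (m = 3 \/ l = 1 /\ m = 5) ((m == 3) || (l == 1) && (m == 5)).
Proof.
apply: (iffP orP) => -[/eqP|]; try by left.
  by case/andP=> /eqP-> /eqP->; right.
by case=> -> ->; right.
Qed.

Lemma disc_ge4 : m = 4 \/ 4 <= m /\ 2 <= l -> 2 <= dsize D.
Proof. by move=> disc; apply: dsize_ind_ge2; lia. Qed.

(** The complex is not a simplex, having two adjacent vertices of the graph, and no vertex can be
    removed, as every deletion is impure. *)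
Lemma not_vertex_decomposable7 : m = 7 -> ~ vertex_decomposable D.
Proof.
move=> m7; suff no D' : vertex_decomposable D' -> D' = D -> False by move/no; apply.
case=> [{}D' _ [F ->] DE|{}D' x _ _ _ /vertex_decomposable_pure purdel DE]; last first.
  by move: purdel; rewrite DE; apply: heptagon_deletion_not_pure.
have inF x : x \in F by rewrite -sub1set -powersetE DE set1_ind.
have FD : F \in D by rewrite -DE powersetE.
have := indcomplexP _ _ FD v0 (shift v0 1) (inF _) (inF _).
by rewrite joinGE // eqxx orbT.
Qed.

Lemma vertex_decomposable_iff : vertex_decomposable D <-> m = 3 \/ l = 1 /\ m = 5.
Proof.
split=> [vd|[->|[-> ->]]].
- apply/goodP; apply: contraT => /bad_cases[mm|disc|[_ m7]].
  + by case/negP: mm; apply/pure_join_iff/vertex_decomposable_pure.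
  + case: (disconnected_ind m3 disc l1).
    exact: vertex_decomposable_connected vd cl (disc_ge4 disc).
  + by case: (not_vertex_decomposable7 m7).
- rewrite triangle_indcomplex; exact: points_vertex_decomposable.
- exact: pentagon_vertex_decomposable.
Qed.

Lemma shellable_iff : shellable D <-> m = 3 \/ l = 1 /\ m = 5.
Proof.
split=> [sh|[m_3|[-> ->]]].
- apply/goodP; apply: contraT => /bad_cases[mm|disc|[l_1 m7]].
  + by case/negP: mm; apply/pure_join_iff; case: sh.
  + case: (disconnected_ind m3 disc l1).
    exact: shellable_connected cl sh (disc_ge4 disc).
  + move: cl sh; rewrite l_1 => cl1 sh; have [nac D3] := heptagon_not_acyclic1 K m3 m7.
    by case: nac; apply: shellable_acyclic1.
- have : [set: 'I_(l * m)] != set0 by apply/set0Pn; exists v0.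
  rewrite m_3 triangle_indcomplex; exact: points_shellable.
- exact: pentagon_shellable.
Qed.

Lemma seqCM_good : m = 3 \/ l = 1 /\ m = 5 -> seqCM K D.
Proof.
move=> good; have le : m./2 <= 2 by case: good => [->|[_ ->]].
apply: seqCM_dsize2 => // [|D2]; first exact: leq_trans (dsize_ind_le _ m3) le.
case: good => [m_3|[l_1 m5]].
  by have := leq_trans D2 (dsize_ind_le l m3); rewrite m_3.
move: cl; rewrite l_1 => cl1; have oddm : odd m by rewrite m5.
apply: odd_cycle_connected => // x; have [|H HD [cH sub]] := step2_facet m3 x.
  by rewrite m5.
by apply/(pure_skeletonP _ _ cl1); exists H => //; split=> //; rewrite cH m5.
Qed.

Lemma CM_good : m = 3 \/ l = 1 /\ m = 5 -> CM K D.
Proof.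
move=> good; have le : m./2 <= 2 by case: good => [->|[_ ->]].
apply: CM_dsize2 => // [|D2]; first exact: leq_trans (dsize_ind_le _ m3) le.
case: good => [m_3|[l_1 m5]].
  by have := leq_trans D2 (dsize_ind_le l m3); rewrite m_3.
by rewrite l_1; apply: odd_cycle_ind_connected; rewrite ?m5.
Qed.

Lemma CM_iff : CM K D <-> m = 3 \/ l = 1 /\ m = 5.
Proof.
split=> [cm|]; last exact: CM_good.
apply/goodP; apply: contraT => /bad_cases[mm|disc|[l_1 m7]].
- have [F [a [b [c [_ P3]]]]] := exists_path3_link m3 v0 (large_cases mm).
  by case: (path3_link_not_CM cl P3 (set0_indcomplex _) cm).
- case: (disconnected_ind m3 disc l1).
  exact: CM_connected cl cm (set0_indcomplex _) (disc_ge4 disc).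
- move: cl cm; rewrite l_1 => cl1 cm; have [nac D3] := heptagon_not_acyclic1 K m3 m7.
  by case: nac; apply: CM_acyclic1 => //; apply: set0_indcomplex.
Qed.

Lemma seqCM_iff : seqCM K D <-> m = 3 \/ l = 1 /\ m = 5.
Proof.
split=> [cm|]; last exact: seqCM_good.
apply/goodP; apply: contraT => bad.
(* Long odd cycles fail in degree 1 on the skeleton of the largest faces; every other bad case has a
   disconnected skeleton. *)
have [[l_1 [oddm m7]]|disc] : (l = 1 /\ odd m /\ 7 <= m) \/
    (4 <= m /\ 2 <= l \/ l = 1 /\ 4 <= m /\ ~~ odd m) by lia.
  have cmS := cm m./2; move: cmS; rewrite l_1 => cmS.
  have [clS nac S0 S3] := odd_cycle_top_skeleton K m3 oddm m7.
  by case: nac; apply: CM_acyclic1.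
have [k [nconn S2]] := skeleton_disconnected m3 l1 disc.
case: nconn; apply: (CM_connected (K := K)) => //; first exact: pure_skeleton_closed.
have [H HS _] := dsize_gt S2; apply: (pure_skeleton_closed cl) HS; exact: sub0set.
Qed.

Lemma S2_iff : S2 D <-> m = 3 \/ l = 1 /\ m \in [:: 5; 7].
Proof.
split=> [s2|good F FD d2].
  have [[mm|disc]|] : (m \notin [:: 3; 4; 5; 7] \/ (m = 4 \/ 4 <= m /\ 2 <= l)) \/
      (m = 3 \/ l = 1 /\ m \in [:: 5; 7]) by rewrite !inE; lia.
  - have [F [a [b [c [_ P3]]]]] := exists_path3_link m3 v0 (large_cases mm).
    case: (path3_link_disconnected cl P3); apply: s2 (path3_link_dsize P3).
    case: P3 => _ [acL _ _]; move: acL; rewrite inE => /and3P[_ _].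
    by apply: cl; apply: subsetUr.
  - case: (disconnected_ind m3 disc l1); rewrite -(link0 cl); apply: s2.
      exact: set0_indcomplex.
    by rewrite link0 // disc_ge4.
  - by [].
(* Here [#|F| + 2 <= m./2], so [F] is empty, or [m = 7] and [F] is a vertex. *)
have [H /(card_ind_le m3) cH /leq_trans/(_ cH) FH] := dsize_link_add d2.
case: good => [m_3|[l_1 mm]]; first by lia.
have [F0|F0] := posnP #|F|.
  move/eqP: F0; rewrite cards_eq0 => /eqP->; rewrite (link0 cl) l_1.
  by apply: odd_cycle_ind_connected; move: mm; rewrite !inE => /orP[]/eqP->.
have [m7 F1] : m = 7 /\ #|F| = 1 by move: mm; rewrite !inE; lia.
move/eqP: F1 => /cards1P[x ->]; exact: link_set1_connected7.
Qed.

End JoinProperties.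

Theorem theorem4p7 (K : fieldType) (l m : nat) :
  1 <= l -> 3 <= m ->
  [/\ induced_matching_number (joinG l m) = m %/ 3,
      (well_covered (joinG l m) <-> m \in [:: 3; 4; 5; 7]) /\
      (buchsbaum K (joinG l m) <-> m \in [:: 3; 4; 5; 7]),
      [/\ vertex_decomposable (indcomplex (joinG l m)) <->
            (l = 1 /\ m \in [:: 3; 5]) \/ (2 <= l /\ m = 3),
          shellable (indcomplex (joinG l m)) <->
            (l = 1 /\ m \in [:: 3; 5]) \/ (2 <= l /\ m = 3),
          CM K (indcomplex (joinG l m)) <->
            (l = 1 /\ m \in [:: 3; 5]) \/ (2 <= l /\ m = 3) &
          seqCM K (indcomplex (joinG l m)) <->
            (l = 1 /\ m \in [:: 3; 5]) \/ (2 <= l /\ m = 3)] &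
      S2 (indcomplex (joinG l m)) <->
        (l = 1 /\ m \in [:: 3; 5; 7]) \/ (2 <= l /\ m = 3)].
Proof.
move=> l1 m3; have lm0 : 0 < l * m by rewrite muln_gt0 l1 (ltn_trans _ m3).
have good : m = 3 \/ l = 1 /\ m = 5 <->
    (l = 1 /\ m \in [:: 3; 5]) \/ (2 <= l /\ m = 3) by rewrite !inE; lia.
split.
- apply/eqP; rewrite eqn_leq induced_matching_le //.
  exact: induced_matching_ge m3 (Ordinal lm0).
- split; last exact: buchsbaum_iff.
  exact: iff_trans (well_covered_pure _) (pure_join_iff l1 m3).
- split; apply: iff_trans _ good.
  + exact: vertex_decomposable_iff.
  + exact: shellable_iff.
  + exact: CM_iff.
  + exact: seqCM_iff.
- apply: iff_trans (S2_iff l1 m3) _; rewrite !inE; lia.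
Qed.
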